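(* Consider the algebras $\epsilon_1,\dots,\epsilon_{25}$ and the algebras $\mathcal{J}_1,\dots,\mathcal{J}_{41}$ (including the parametric families $\mathcal{J}_{15}^{\alpha}$, $\mathcal{J}_{23}^{\beta}$, $\mathcal{J}_{24}^{\gamma}$, $\mathcal{J}_{26}^{\delta}$, $\mathcal{J}_{27}^{\varepsilon,\phi}$, $\mathcal{J}_{41}^{\lambda}$) listed in the context. All these algebras are pairwise non-isomorphic except for the following: 1. $\mathcal{J}_{15}^{\alpha_1}\simeq\mathcal{J}_{15}^{\alpha_2}$ if and only if $\alpha_1=\alpha_2$, and $\mathcal{J}_{24}^{\alpha_1}\simeq\mathcal{J}_{24}^{\alpha_2}$ if and only if $\alpha_1=\alpha_2$; 2. $\mathcal{J}_{23}^{\beta_1}\simeq\mathcal{J}_{23}^{\beta_2}$ if and only if $\beta_1=\pm\beta_2$, and $\mathcal{J}_{26}^{\beta_1}\simeq\mathcal{J}_{26}^{\beta_2}$ if and only if $\beta_1=\pm\beta_2$; 3. $\mathcal{J}_{27}^{\alpha_1,\beta_1}\simeq\mathcal{J}_{27}^{\alpha_2,\beta_2}$ if and only if $(\alpha_1,\beta_1)=(\alpha_2,\beta_2)$ or $(\alpha_1,\beta_1)=(\beta_2,\alpha_2)$; 4. $\mathcal{J}_{41}^{\lambda_1}\simeq\mathcal{J}_{41}^{\lambda_2}$ if and only if $\lambda_1=\lambda_2$ or $\lambda_1=\lambda_2^{-1}$; 5. the algebra $\mathcal{J}_{24}^{1}$ (given by the multiplication table of the family $\mathcal{J}_{24}^\gamma$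 at $\gamma=1$) is associative and isomorphic to $\epsilon_4$; 6. $\mathcal{J}_{29}\simeq\mathcal{J}_{24}^{0}$; 7. $\mathcal{J}_{37}\simeq\mathcal{J}_{27}^{-1,-1}$; 8. for $\lambda\neq0,1$, $\mathcal{J}_{41}^{\lambda}\simeq\mathcal{J}_{27}^{\varepsilon,\varepsilon^{-1}}$ with $\varepsilon=-\frac{(-1+\sqrt{\lambda})^2}{(1+\sqrt{\lambda})^2}$, while $\mathcal{J}_{41}^{1}\simeq\mathcal{J}_{26}^{0}$; thus in the family $\mathcal{J}_{41}^\lambda$ there remains only $\mathcal{J}_{41}^{0}$.
   Context: $\mathbf{k}$ is an algebraically closed field of characteristic $\neq2,3$. A Jordan algebra is a commutative $\mathbf{k}$-algebra with $((xx)y)x=(xx)(yx)$ for all $x,y$. All algebras below are commutative five-dimensional with basis $n_1,\dots,n_5$ (nilpotent Jordan); products not listed are zero or determined by commutativity. $\sqrt{\lambda}$ denotes a square root of $\lambda$ in $\mathbf{k}$. Associative algebras: - $\epsilon_1$: $n_1^2=n_2$, $n_1n_2=n_3$, $n_2^2=n_1n_3=n_4$, $n_1n_4=n_2n_3=n_5$. - $\epsilon_2$: $n_1^2=n_2$, $n_1n_2=n_3$, $n_2^2=n_1n_3=n_5^2=n_4$. - $\epsilon_3$: $n_1^2=n_2$, $n_4^2=n_5$, $n_1n_2=n_4n_5=n_3$. - $\epsilon_4$: $n_1^2=n_3$, $n_1n_2=n_4$, $n_1n_4=n_2n_3=n_5$. - $\epsilon_5$: $n_1^2=n_2$, $n_1n_2=n_3$,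 $n_2^2=n_1n_3=n_4$. - $\epsilon_6$: $n_1^2=n_2$, $n_1n_2=n_3$, $n_4^2=n_5$. - $\epsilon_7$: $n_1n_3=n_4$, $n_2n_3=n_5$, $n_1n_2=n_4-n_5$. - $\epsilon_8$: $n_1^2=n_3$, $n_2^2=n_1n_3=n_4$, $n_1n_2=n_5$. - $\epsilon_9$: $n_1n_3=n_5$, $n_1n_2=n_4$, $n_2n_3=-n_5$. - $\epsilon_{10}$: $n_1^2=n_3$, $n_1n_3=n_4$, $n_1n_2=n_5$. - $\epsilon_{11}$: $n_1^2=n_2n_3=n_4$, $n_1n_3=n_5$. - $\epsilon_{12}$: $n_1n_2=n_4$, $n_1n_3=n_5$. - $\epsilon_{13}$: $n_3^2=n_4$, $n_1n_2=n_3n_4=n_5$. - $\epsilon_{14}$: $n_1^2=n_2$, $n_4^2=n_1n_2=n_3$. - $\epsilon_{15}$: $n_1^2=n_2^2=n_3$, $n_4^2=n_5$. - $\epsilon_{16}$: $n_1^2=n_3$, $n_2^2=n_5$, $n_1n_2=n_4$. - $\epsilon_{17}$: $n_1^2=n_4$, $n_3^2=n_1n_2=n_5$. - $\epsilon_{18}$: $n_1^2=n_2$, $n_1n_2=n_3$. - $\epsilon_{19}$: $n_1^2=n_2$, $n_3^2=n_4$. - $\epsilon_{20}$: $n_1^2=n_2$, $n_1n_3=n_4$. - $\epsilon_{21}$: $n_2n_3=n_1n_4=n_5$. - $\epsilon_{22}$: $n_1^2=n_3n_4=n_2$. - $\epsilon_{23}$: $n_1^2=n_2^2=n_3$. - $\epsilon_{24}$: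 $n_1^2=n_2$. - $\epsilon_{25}$: all products zero. Non-associative algebras: - $\mathcal{J}_1$: $n_1^2=n_2$, $n_1n_2=n_2n_4=n_3$. - $\mathcal{J}_2$: $n_1^2=n_2$, $n_4^2=-n_2$, $n_1n_2=n_2n_4=n_3$. - $\mathcal{J}_3$: $n_1^2=n_2$, $n_4^2=-n_2-n_3$, $n_1n_2=n_2n_4=n_3$. - $\mathcal{J}_4$: $n_1^2=n_4^2=n_2$, $n_1n_2=n_3$. - $\mathcal{J}_5$: $n_1^2=n_2$, $n_4^2=n_2n_3=n_5$. - $\mathcal{J}_6$: $n_1^2=n_2$, $n_1n_4=n_2n_3=n_5$. - $\mathcal{J}_7$: $n_1n_2=n_3$, $n_3n_4=n_5$. - $\mathcal{J}_8$: $n_1n_2=n_3$, $n_3n_4=n_1^2=n_5$. - $\mathcal{J}_9$: $n_1n_2=n_3$, $n_3n_4=n_1^2=n_2^2=n_5$. - $\mathcal{J}_{10}$: $n_1n_2=n_3$, $n_1n_3=n_4^2=n_2n_3=n_5$. - $\mathcal{J}_{11}$: $n_1n_2=n_3$, $n_1n_3=n_4^2=n_5$. - $\mathcal{J}_{12}$: $n_1n_2=n_3$, $n_1n_3=n_4^2=n_2^2=n_5$. - $\mathcal{J}_{13}$: $n_1n_2=n_3$, $n_1n_4=n_1n_3=n_2n_3=n_5$. - $\mathcal{J}_{14}$: $n_1n_2=n_3$, $n_1n_3=n_2n_4=n_5$. - $\mathcal{J}_{15}^{\alpha}$ ($\alpha\in\mathbf{k}$): $n_1^2=n_2$, $n_1n_2=n_3$,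 $n_4^2=\alpha n_5$, $n_2^2=n_1n_3=n_2n_4=n_5$. - $\mathcal{J}_{16}$: $n_1n_2=n_3^2=n_4$, $n_1n_4=n_5$. - $\mathcal{J}_{17}$: $n_1n_2=n_3^2=n_4$, $n_1n_4=n_2n_3=n_5$. - $\mathcal{J}_{18}$: $n_1n_2=n_3^2=n_4$, $n_1n_4=n_2^2=n_5$. - $\mathcal{J}_{19}$: $n_1n_2=n_3^2=n_4$, $n_3n_4=n_5$. - $\mathcal{J}_{20}$: $n_1n_2=n_3^2=n_4$, $n_3n_4=n_1^2=n_5$. - $\mathcal{J}_{21}$: $n_1n_2=n_3^2=n_4$, $n_3n_4=n_1^2=n_2^2=n_5$. - $\mathcal{J}_{22}$: $n_1^2=n_2$, $n_1n_2=n_3^2=n_4$, $n_2^2=n_1n_4=n_5$. - $\mathcal{J}_{23}^{\beta}$ ($\beta\in\mathbf{k}$): $n_1^2=n_3$, $n_1n_2=n_4$, $n_1n_3=n_2n_4=n_5$, $n_2n_3=\beta n_5$. - $\mathcal{J}_{24}^{\gamma}$ ($\gamma\in\mathbf{k}$, $\gamma\neq1$): $n_1^2=n_3$, $n_1n_2=n_4$, $n_2n_3=n_5$, $n_1n_4=\gamma n_5$. - $\mathcal{J}_{25}$: $n_1^2=n_3$, $n_1n_2=n_4$, $n_1n_3=n_1n_4=n_5$, $n_2n_3=-2n_5$. - $\mathcal{J}_{26}^{\delta}$ ($\delta\in\mathbf{k}$): $n_1^2=n_3$, $n_2^2=n_4$, $n_2n_4=\delta n_5$, $n_1n_3=n_1n_4=n_5$.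 - $\mathcal{J}_{27}^{\varepsilon,\phi}$ ($\varepsilon,\phi\in\mathbf{k}$): $n_1^2=n_3$, $n_2^2=n_4$, $n_2n_3=n_1n_4=n_5$, $n_2n_4=\varepsilon n_5$, $n_1n_3=\phi n_5$. - $\mathcal{J}_{28}$: $n_1^2=n_2$, $n_2n_3=n_4$, $n_3^2=n_5$. - $\mathcal{J}_{29}$: $n_1^2=n_2$, $n_2n_3=n_4$, $n_1n_3=n_5$. - $\mathcal{J}_{30}$: $n_1^2=n_2$, $n_2n_3=n_4$, $n_1n_3=n_3^2=n_5$. - $\mathcal{J}_{31}$: $n_1^2=n_2$, $n_2n_3=n_4$, $n_1n_2=n_5$. - $\mathcal{J}_{32}$: $n_1^2=n_2$, $n_2n_3=n_4$, $n_1n_2=n_1n_3=n_5$. - $\mathcal{J}_{33}$: $n_1^2=n_2$, $n_2n_3=n_4$, $n_1n_2=n_3^2=n_5$. - $\mathcal{J}_{34}$: $n_1n_2=n_3$, $n_1n_3=n_4$, $n_1^2=n_5$. - $\mathcal{J}_{35}$: $n_1n_2=n_3$, $n_1n_3=n_4$, $n_2^2=n_5$. - $\mathcal{J}_{36}$: $n_1n_2=n_3$, $n_1n_3=n_4$, $n_2n_3=n_5$. - $\mathcal{J}_{37}$: $n_1^2=n_2^2=n_5$, $n_1n_2=n_3$, $n_1n_3=n_4$. - $\mathcal{J}_{38}$: $n_1n_2=n_3$, $n_1n_3=n_4$, $n_1^2=n_2n_3=n_5$. - $\mathcal{J}_{39}$: $n_1n_2=n_3$, $n_1^2=n_5$,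 $n_2^2=n_1n_3=n_4$. - $\mathcal{J}_{40}$: $n_1n_2=n_3$, $n_2^2=n_1n_3=n_4$, $n_1^2=n_2n_3=n_5$. - $\mathcal{J}_{41}^{\lambda}$ ($\lambda\in\mathbf{k}$): $n_1^2=n_5$, $n_1n_2=n_3$, $n_2^2=\lambda n_5$, $n_1n_3=n_2n_3=n_4$. *)

(* Defs.v *)
From mathcomp Require Import all_boot all_algebra.

Set Implicit Arguments.
Unset Strict Implicit.
Unset Printing Implicit Defensive.

Import GRing.Theory.
Local Open Scope ring_scope.

Section StructureConstants.
Variable K : fieldType.

(* The basis is numbered from 1: [n 1, ..., n 5]; [n i = 0] for other [i]. *)
Definition n (i : nat) : 'rV[K]_5 := \row_(j < 5) (j.+1 == i)%:R.

(* A multiplication table is the list of its non-zero products, an entry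
   ((i, j), v) standing for n_i n_j = n_j n_i = v; a pair {i, j} must occur in
   at most one entry, otherwise the values would be added. *)
Definition table := seq ((nat * nat) * 'rV[K]_5).

Definition basis_mul (t : table) (i j : 'I_5) : 'rV[K]_5 :=
  \sum_(e <- t | (e.1 == (i.+1, j.+1)) || (e.1 == (j.+1, i.+1))) e.2.

Definition table_mul (t : table) (x y : 'rV[K]_5) : 'rV[K]_5 :=
  \sum_(i < 5) \sum_(j < 5) (x 0 i * y 0 j) *: basis_mul t i j.

Definition isomorphic (t u : table) : Prop :=
  exists f : {linear 'rV[K]_5 -> 'rV[K]_5},
    bijective f /\ forall x y, f (table_mul t x y) = table_mul u (f x) (f y).

End StructureConstants.

Arguments n {K} i.

Section Algebras.
Variable K : fieldType.

Local Notation "i ** j ~> v" := (@pair (nat * nat) 'rV[K]_5 (i%N, j%N) v)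
  (at level 60, j at next level, v at level 59, no associativity).

(* Names of the algebras; [Jk] carries the parameters of the k-th family. *)
Inductive label :=
  | eps1 | eps2 | eps3 | eps4 | eps5 | eps6 | eps7 | eps8 | eps9 | eps10
  | eps11 | eps12 | eps13 | eps14 | eps15 | eps16 | eps17 | eps18 | eps19
  | eps20 | eps21 | eps22 | eps23 | eps24 | eps25 | J1 | J2 | J3 | J4 | J5
  | J6 | J7 | J8 | J9 | J10 | J11 | J12 | J13 | J14 | J15 (alpha : K) | J16
  | J17 | J18 | J19 | J20 | J21 | J22 | J23 (beta : K) | J24 (gamma : K)
  | J25 | J26 (delta : K) | J27 (epsilon phi : K) | J28 | J29 | J30 | J31
  | J32 | J33 | J34 | J35 | J36 | J37 | J38 | J39 | J40 | J41 (lambda : K).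

Definition alg (a : label) : table K :=
  match a with
  | eps1 =>
      [:: 1 ** 1 ~> n 2; 1 ** 2 ~> n 3; 2 ** 2 ~> n 4; 1 ** 3 ~> n 4;
          1 ** 4 ~> n 5; 2 ** 3 ~> n 5]
  | eps2 =>
      [:: 1 ** 1 ~> n 2; 1 ** 2 ~> n 3; 2 ** 2 ~> n 4; 1 ** 3 ~> n 4;
          5 ** 5 ~> n 4]
  | eps3 => [:: 1 ** 1 ~> n 2; 4 ** 4 ~> n 5; 1 ** 2 ~> n 3; 4 ** 5 ~> n 3]
  | eps4 => [:: 1 ** 1 ~> n 3; 1 ** 2 ~> n 4; 1 ** 4 ~> n 5; 2 ** 3 ~> n 5]
  | eps5 => [:: 1 ** 1 ~> n 2; 1 ** 2 ~> n 3; 2 ** 2 ~> n 4; 1 ** 3 ~> n 4]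
  | eps6 => [:: 1 ** 1 ~> n 2; 1 ** 2 ~> n 3; 4 ** 4 ~> n 5]
  | eps7 => [:: 1 ** 3 ~> n 4; 2 ** 3 ~> n 5; 1 ** 2 ~> n 4 - n 5]
  | eps8 => [:: 1 ** 1 ~> n 3; 2 ** 2 ~> n 4; 1 ** 3 ~> n 4; 1 ** 2 ~> n 5]
  | eps9 => [:: 1 ** 3 ~> n 5; 1 ** 2 ~> n 4; 2 ** 3 ~> - n 5]
  | eps10 => [:: 1 ** 1 ~> n 3; 1 ** 3 ~> n 4; 1 ** 2 ~> n 5]
  | eps11 => [:: 1 ** 1 ~> n 4; 2 ** 3 ~> n 4; 1 ** 3 ~> n 5]
  | eps12 => [:: 1 ** 2 ~> n 4; 1 ** 3 ~> n 5]
  | eps13 => [:: 3 ** 3 ~> n 4; 1 ** 2 ~> n 5; 3 ** 4 ~> n 5]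
  | eps14 => [:: 1 ** 1 ~> n 2; 4 ** 4 ~> n 3; 1 ** 2 ~> n 3]
  | eps15 => [:: 1 ** 1 ~> n 3; 2 ** 2 ~> n 3; 4 ** 4 ~> n 5]
  | eps16 => [:: 1 ** 1 ~> n 3; 2 ** 2 ~> n 5; 1 ** 2 ~> n 4]
  | eps17 => [:: 1 ** 1 ~> n 4; 3 ** 3 ~> n 5; 1 ** 2 ~> n 5]
  | eps18 => [:: 1 ** 1 ~> n 2; 1 ** 2 ~> n 3]
  | eps19 => [:: 1 ** 1 ~> n 2; 3 ** 3 ~> n 4]
  | eps20 => [:: 1 ** 1 ~> n 2; 1 ** 3 ~> n 4]
  | eps21 => [:: 2 ** 3 ~> n 5; 1 ** 4 ~> n 5]
  | eps22 => [:: 1 ** 1 ~> n 2; 3 ** 4 ~> n 2]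
  | eps23 => [:: 1 ** 1 ~> n 3; 2 ** 2 ~> n 3]
  | eps24 => [:: 1 ** 1 ~> n 2]
  | eps25 => [::]
  | J1 => [:: 1 ** 1 ~> n 2; 1 ** 2 ~> n 3; 2 ** 4 ~> n 3]
  | J2 => [:: 1 ** 1 ~> n 2; 4 ** 4 ~> - n 2; 1 ** 2 ~> n 3; 2 ** 4 ~> n 3]
  | J3 =>
      [:: 1 ** 1 ~> n 2; 4 ** 4 ~> - n 2 - n 3; 1 ** 2 ~> n 3; 2 ** 4 ~> n 3]
  | J4 => [:: 1 ** 1 ~> n 2; 4 ** 4 ~> n 2; 1 ** 2 ~> n 3]
  | J5 => [:: 1 ** 1 ~> n 2; 4 ** 4 ~> n 5; 2 ** 3 ~> n 5]
  | J6 => [:: 1 ** 1 ~> n 2; 1 ** 4 ~> n 5; 2 ** 3 ~> n 5]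
  | J7 => [:: 1 ** 2 ~> n 3; 3 ** 4 ~> n 5]
  | J8 => [:: 1 ** 2 ~> n 3; 3 ** 4 ~> n 5; 1 ** 1 ~> n 5]
  | J9 => [:: 1 ** 2 ~> n 3; 3 ** 4 ~> n 5; 1 ** 1 ~> n 5; 2 ** 2 ~> n 5]
  | J10 => [:: 1 ** 2 ~> n 3; 1 ** 3 ~> n 5; 4 ** 4 ~> n 5; 2 ** 3 ~> n 5]
  | J11 => [:: 1 ** 2 ~> n 3; 1 ** 3 ~> n 5; 4 ** 4 ~> n 5]
  | J12 => [:: 1 ** 2 ~> n 3; 1 ** 3 ~> n 5; 4 ** 4 ~> n 5; 2 ** 2 ~> n 5]
  | J13 => [:: 1 ** 2 ~> n 3; 1 ** 4 ~> n 5; 1 ** 3 ~> n 5; 2 ** 3 ~> n 5]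
  | J14 => [:: 1 ** 2 ~> n 3; 1 ** 3 ~> n 5; 2 ** 4 ~> n 5]
  | J15 alpha =>
      [:: 1 ** 1 ~> n 2; 1 ** 2 ~> n 3; 4 ** 4 ~> alpha *: n 5; 2 ** 2 ~> n 5;
          1 ** 3 ~> n 5; 2 ** 4 ~> n 5]
  | J16 => [:: 1 ** 2 ~> n 4; 3 ** 3 ~> n 4; 1 ** 4 ~> n 5]
  | J17 => [:: 1 ** 2 ~> n 4; 3 ** 3 ~> n 4; 1 ** 4 ~> n 5; 2 ** 3 ~> n 5]
  | J18 => [:: 1 ** 2 ~> n 4; 3 ** 3 ~> n 4; 1 ** 4 ~> n 5; 2 ** 2 ~> n 5]
  | J19 => [:: 1 ** 2 ~> n 4; 3 ** 3 ~> n 4; 3 ** 4 ~> n 5]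
  | J20 => [:: 1 ** 2 ~> n 4; 3 ** 3 ~> n 4; 3 ** 4 ~> n 5; 1 ** 1 ~> n 5]
  | J21 =>
      [:: 1 ** 2 ~> n 4; 3 ** 3 ~> n 4; 3 ** 4 ~> n 5; 1 ** 1 ~> n 5;
          2 ** 2 ~> n 5]
  | J22 =>
      [:: 1 ** 1 ~> n 2; 1 ** 2 ~> n 4; 3 ** 3 ~> n 4; 2 ** 2 ~> n 5;
          1 ** 4 ~> n 5]
  | J23 beta =>
      [:: 1 ** 1 ~> n 3; 1 ** 2 ~> n 4; 1 ** 3 ~> n 5; 2 ** 4 ~> n 5;
          2 ** 3 ~> beta *: n 5]
  | J24 gamma =>
      [:: 1 ** 1 ~> n 3; 1 ** 2 ~> n 4; 2 ** 3 ~> n 5; 1 ** 4 ~> gamma *: n 5]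
  | J25 =>
      [:: 1 ** 1 ~> n 3; 1 ** 2 ~> n 4; 1 ** 3 ~> n 5; 1 ** 4 ~> n 5;
          2 ** 3 ~> - 2%:R *: n 5]
  | J26 delta =>
      [:: 1 ** 1 ~> n 3; 2 ** 2 ~> n 4; 2 ** 4 ~> delta *: n 5; 1 ** 3 ~> n 5;
          1 ** 4 ~> n 5]
  | J27 epsilon phi =>
      [:: 1 ** 1 ~> n 3; 2 ** 2 ~> n 4; 2 ** 3 ~> n 5; 1 ** 4 ~> n 5;
          2 ** 4 ~> epsilon *: n 5; 1 ** 3 ~> phi *: n 5]
  | J28 => [:: 1 ** 1 ~> n 2; 2 ** 3 ~> n 4; 3 ** 3 ~> n 5]
  | J29 => [:: 1 ** 1 ~> n 2; 2 ** 3 ~> n 4; 1 ** 3 ~> n 5]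
  | J30 => [:: 1 ** 1 ~> n 2; 2 ** 3 ~> n 4; 1 ** 3 ~> n 5; 3 ** 3 ~> n 5]
  | J31 => [:: 1 ** 1 ~> n 2; 2 ** 3 ~> n 4; 1 ** 2 ~> n 5]
  | J32 => [:: 1 ** 1 ~> n 2; 2 ** 3 ~> n 4; 1 ** 2 ~> n 5; 1 ** 3 ~> n 5]
  | J33 => [:: 1 ** 1 ~> n 2; 2 ** 3 ~> n 4; 1 ** 2 ~> n 5; 3 ** 3 ~> n 5]
  | J34 => [:: 1 ** 2 ~> n 3; 1 ** 3 ~> n 4; 1 ** 1 ~> n 5]
  | J35 => [:: 1 ** 2 ~> n 3; 1 ** 3 ~> n 4; 2 ** 2 ~> n 5]
  | J36 => [:: 1 ** 2 ~> n 3; 1 ** 3 ~> n 4; 2 ** 3 ~> n 5]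
  | J37 => [:: 1 ** 1 ~> n 5; 2 ** 2 ~> n 5; 1 ** 2 ~> n 3; 1 ** 3 ~> n 4]
  | J38 => [:: 1 ** 2 ~> n 3; 1 ** 3 ~> n 4; 1 ** 1 ~> n 5; 2 ** 3 ~> n 5]
  | J39 => [:: 1 ** 2 ~> n 3; 1 ** 1 ~> n 5; 2 ** 2 ~> n 4; 1 ** 3 ~> n 4]
  | J40 =>
      [:: 1 ** 2 ~> n 3; 2 ** 2 ~> n 4; 1 ** 3 ~> n 4; 1 ** 1 ~> n 5;
          2 ** 3 ~> n 5]
  | J41 lambda =>
      [:: 1 ** 1 ~> n 5; 1 ** 2 ~> n 3; 2 ** 2 ~> lambda *: n 5; 1 ** 3 ~> n 4;
          2 ** 3 ~> n 4]
  end.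

(* The family J24 excludes the parameter 1, although its table makes sense
   there. *)
Definition listed (a : label) : Prop :=
  match a with J24 gamma => gamma <> 1 | _ => True end.

(* Two square roots s and - s of lambda give inverse values. *)
Definition param27 (s : K) : K := - ((- 1 + s) ^+ 2 / (1 + s) ^+ 2).

(* The isomorphisms between listed algebras and J24 1, each constructor being
   oriented: the relation is to be read up to symmetry. The degenerate
   instances (such as [exc41 0], where 0^-1 = 0) relate an algebra to itself. *)
Inductive exceptional : label -> label -> Prop :=
  | exc23 beta : exceptional (J23 beta) (J23 (- beta))
  | exc26 delta : exceptional (J26 delta) (J26 (- delta))
  | exc27 epsilon phi : exceptional (J27 epsilon phi) (J27 phi epsilon)
  | exc41 lambda : exceptional (J41 lambda) (J41 lambda^-1)
  | exc24_1 : exceptional (J24 1) eps4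
  | exc29 : exceptional J29 (J24 0)
  | exc37 : exceptional J37 (J27 (- 1) (- 1))
  | exc41_27 lambda s : lambda <> 0 -> lambda <> 1 -> s ^+ 2 = lambda ->
      exceptional (J41 lambda) (J27 (param27 s) (param27 s)^-1)
  | exc41_1 : exceptional (J41 1) (J26 0).

End Algebras.

Notation "a \simeq b" := (isomorphic (alg a) (alg b))
  (at level 70, no associativity).

(* Main.v *)
From Stdlib Require Import ZArith.
Require Import Defs.
From HB Require Import structures.
From mathcomp Require Import all_boot all_algebra.
From mathcomp Require Import ring zify ssrZ.

(* An isomorphism A -> B carries the operators D on A that satisfy a given
   multilinear identity, such as D (x y) = (D x) y + x (D y), to the operators
   on B that satisfy the same identity, so the dimension of the space of these
   operators is an invariant. Five such dimensions separate all algebras of the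
   list without parameters that do not have dim A^2 = 3 and dim A^3 = 1, and
   two of them isolate the family J15, whose parameter is then recovered by
   hand. The structure constants are integers, and Gaussian elimination over Z
   with pivots dividing a power of 6 gives each dimension in all
   characteristics other than 2 and 3 at once.

   If dim A^2 = 3 and dim A^3 = 1, then A is generated by a plane V, the kernel
   of S^2 V -> A^2 / A^3 is spanned by one quadratic form, a square or a product
   of two distinct lines, and the product V x (A^2 / A^3) -> A^3 has at most
   four coefficients. An isomorphism acts on them through a 2 x 2 matrix
   preserving the quadratic form up to a scalar, and one reads off the
   invariants. *)

Set Implicit Arguments.
Unset Strict Implicit.
Unset Printing Implicit Defensive.

Import GRing.Theory.
Local Open Scope ring_scope.
Local Delimit Scope Z_scope with Zc.

(** * Coordinates and isomorphisms *)

Section Coordinates.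
Variable K : fieldType.
Implicit Types (x y z : 'rV[K]_5) (t u : table K).

(** The rank of an integer matrix may drop in some characteristics, so the elimination returns a
    dimension only when every pivot is visibly invertible in [K]; a single run is then valid for all
    the fields at once. Tables with parameters are out of its reach. For J15 only identities in the
    products x (y z) are used, which do not see the parameter; for the algebras generated by a
    plane, only the operators vanishing on A^2 or on A^3, which are the same for all members. In the
    second half a double line in V is preserved, which makes the 2 x 2 matrix triangular, whereas
    two distinct lines are kept or exchanged, which makes it monomial. Coincidences in the list come
    from tables written in a basis of V that is not adapted to the quadratic form. For J41 this form
    is lambda n_1^2 - n_2^2: its factors need a square root of lambda, and this is where algebraic
    closedness enters. *)

Definition co x (i : nat) : K := \sum_(j < 5 | j.+1 == i) x 0 j.

Lemma co_ord x (j : 'I_5) : co x j.+1 = x 0 j.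
Proof. by rewrite /co (big_pred1 j). Qed.

Lemma coD x y i : co (x + y) i = co x i + co y i.
Proof. by rewrite /co -big_split; apply: eq_bigr => j _; rewrite mxE. Qed.

Lemma coZ a x i : co (a *: x) i = a * co x i.
Proof. by rewrite /co mulr_sumr; apply: eq_bigr => j _; rewrite mxE. Qed.

Lemma coN x i : co (- x) i = - co x i.
Proof. by rewrite -scaleN1r coZ mulN1r. Qed.

Lemma co0 i : co 0 i = 0.
Proof. by rewrite -(scale0r 0) coZ mul0r. Qed.

Lemma co_sum (I : Type) (r : seq I) (P : pred I) (F : I -> 'rV[K]_5) i :
  co (\sum_(k <- r | P k) F k) i = \sum_(k <- r | P k) co (F k) i.
Proof.
by elim/big_ind2: _ => [|? ? ? ? <- <-|//]; rewrite ?co0 ?coD.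
Qed.

Lemma co_n k i : (0 < i <= 5)%N -> co (n k) i = (k == i)%:R.
Proof.
move=> /andP[]; case: i => // i _ lti.
by rewrite (co_ord _ (Ordinal lti)) mxE eq_sym.
Qed.

Lemma vecP x y : (forall i, (0 < i <= 5)%N -> co x i = co y i) -> x = y.
Proof.
by move=> eq_co; apply/rowP => j; rewrite -!co_ord eq_co //= ltn_ord.
Qed.

Lemma vecP5 x y :
    [/\ co x 1 = co y 1, co x 2 = co y 2, co x 3 = co y 3, co x 4 = co y 4
      & co x 5 = co y 5] -> x = y.
Proof.
by case=> *; apply: vecP; case=> [|[|[|[|[|[|i]]]]]].
Qed.

Definition coE := (coD, coN, coZ, co0).

Lemma vecE x : x = co x 1 *: n 1 + co x 2 *: n 2 + co x 3 *: n 3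
                 + co x 4 *: n 4 + co x 5 *: n 5.
Proof. by apply: vecP5; split; rewrite !coE !co_n //=; ring. Qed.

Lemma vec_sum x : x = \sum_(i < 5) co x i.+1 *: n i.+1.
Proof. by rewrite {1}[x]vecE !big_ord_recl big_ord0 addr0 !addrA. Qed.

(** The weight of an entry in a product. A diagonal entry meets both alternatives of [basis_mul] but
    is counted once, hence the case distinction. *)
Definition pairing (e : nat * nat) x y : K :=
  if e.1 == e.2 then co x e.1 * co y e.1
  else co x e.1 * co y e.2 + co x e.2 * co y e.1.

Lemma pairing_sum e x y :
  pairing e x y =
  \sum_(i < 5) \sum_(j < 5)
    x 0 i * y 0 j * ((e == (i.+1, j.+1)) || (e == (j.+1, i.+1)))%:R.
Proof.
have coM a b : co x a * co y b =
    \sum_(i < 5) \sum_(j < 5) x 0 i * y 0 j * ((a, b) == (i.+1, j.+1))%:R.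
  rewrite /co mulr_suml big_mkcond; apply: eq_bigr => i _.
  rewrite mulr_sumr big_mkcond /=; case: ifP => ai.
    apply: eq_bigr => j _; rewrite xpair_eqE [a == _]eq_sym ai [b == _]eq_sym.
    by case: eqP; rewrite ?mulr1 ?mulr0.
  by rewrite big1 // => j _; rewrite xpair_eqE [a == _]eq_sym ai mulr0.
case: e => a b; rewrite /pairing /=; case: eqP => [<-|/eqP neq_ab].
  rewrite coM; apply: eq_bigr => i _; apply: eq_bigr => j _.
  by rewrite !xpair_eqE [X in _ || X]andbC orbb.
rewrite [co x b * _]mulrC [co y a * _]mulrC !coM -big_split /=.
apply: eq_bigr => i _; rewrite -big_split /=; apply: eq_bigr => j _.
rewrite -mulrDr !xpair_eqE; congr (_ * _).
case: eqP => [ai|_] /=; last by rewrite add0r /= andbC.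
have [bi|_] /= := eqVneq b i.+1; first by rewrite ai bi eqxx in neq_ab.
by rewrite addr0 andbF orbF.
Qed.

Lemma mulE t x y : table_mul t x y = \sum_(e <- t) pairing e.1 x y *: e.2.
Proof.
rewrite /table_mul; under eq_bigr => i _ do under eq_bigr => j _ do
  rewrite /basis_mul scaler_sumr big_mkcond.
under eq_bigr => i _ do rewrite exchange_big.
rewrite exchange_big; apply: eq_bigr => e _.
rewrite pairing_sum scaler_suml; apply: eq_bigr => i _.
rewrite scaler_suml; apply: eq_bigr => j _.
by case: ifP; rewrite ?mulr1 ?mulr0 ?scale0r.
Qed.

Lemma pairingC e x y : pairing e x y = pairing e y x.
Proof. by rewrite /pairing; case: ifP => _; ring. Qed.

Lemma table_mulC t x y : table_mul t x y = table_mul t y x.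
Proof. by rewrite !mulE; apply: eq_bigr => e _; rewrite pairingC. Qed.

Lemma table_mulPl t a x y z :
  table_mul t (a *: x + y) z = a *: table_mul t x z + table_mul t y z.
Proof.
rewrite !mulE scaler_sumr -big_split; apply: eq_bigr => e _ /=.
rewrite scalerA -scalerDl; congr (_ *: _).
by rewrite /pairing !coE; case: ifP => _; ring.
Qed.

Lemma table_mulPr t a x y z :
  table_mul t z (a *: x + y) = a *: table_mul t z x + table_mul t z y.
Proof. by rewrite ![_ t z _]table_mulC table_mulPl. Qed.

Lemma table_mul0l t x : table_mul t 0 x = 0.
Proof.
have := table_mulPl t (-1) 0 0 x.
by rewrite scaler0 addr0 scaleN1r addNr.
Qed.

Lemma table_mulZl t a x y : table_mul t (a *: x) y = a *: table_mul t x y.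
Proof. by rewrite -[a *: x]addr0 table_mulPl table_mul0l addr0. Qed.

Lemma table_mulZr t a x y : table_mul t y (a *: x) = a *: table_mul t y x.
Proof. by rewrite table_mulC table_mulZl table_mulC. Qed.

Lemma isomorphic_of_cancel t u (f g : 'rV[K]_5 -> 'rV[K]_5) :
    linear f -> cancel f g -> cancel g f ->
    (forall x y, f (table_mul t x y) = table_mul u (f x) (f y)) ->
  isomorphic t u.
Proof.
move=> lin_f fK gK fM.
pose F := HB.pack_for {linear 'rV[K]_5 -> 'rV[K]_5} f
  (GRing.isLinear.Build K _ _ _ f lin_f).
by exists F; split=> //; exists g.
Qed.

Lemma isomorphic_inv t u (f : {linear 'rV[K]_5 -> 'rV[K]_5}) :
    bijective f ->
    (forall x y, f (table_mul t x y) = table_mul u (f x) (f y)) ->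
  exists g : {linear 'rV[K]_5 -> 'rV[K]_5},
    [/\ cancel f g, cancel g f
      & forall x y, g (table_mul u x y) = table_mul t (g x) (g y)].
Proof.
case=> g fK gK fM.
have lin_g : linear g.
  by move=> a x y; apply: (can_inj fK); rewrite linearP !gK.
exists (HB.pack_for {linear 'rV[K]_5 -> 'rV[K]_5} g
  (GRing.isLinear.Build K _ _ _ g lin_g)); split=> //= x y.
by apply: (can_inj fK); rewrite fM !gK.
Qed.

Lemma isomorphic_refl t : isomorphic t t.
Proof. by apply: (@isomorphic_of_cancel _ _ id id). Qed.

Lemma isomorphic_sym t u : isomorphic t u -> isomorphic u t.
Proof.
case=> f [bij_f fM]; have [g [fK gK gM]] := isomorphic_inv bij_f fM.
by exists g; split=> //; exists f.
Qed.

Lemma isomorphic_trans t u v :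
  isomorphic t u -> isomorphic u v -> isomorphic t v.
Proof.
case=> f [bij_f fM] [g [bij_g gM]].
exists (g \o f); split; first exact: bij_comp.
by move=> x y /=; rewrite fM gM.
Qed.

End Coordinates.

(** * Dimensions of solution spaces *)

Section Dimension.
Variable K : fieldType.

Definition has_dim (V : vectType K) (S : V -> Prop) (d : nat) :=
  exists2 U : {vspace V}, \dim U = d & forall v, v \in U <-> S v.

Lemma has_dim_image (V W : vectType K) (S : V -> Prop) (T : W -> Prop) d
    (f : V -> W) :
  linear f -> injective f -> (forall w, T w <-> exists2 v, S v & w = f v) ->
  has_dim S d -> has_dim T d.
Proof.
move=> lin_f inj_f TE [U dimU US].
pose F := HB.pack_for {linear V -> W} f (GRing.isLinear.Build K _ _ _ f lin_f).
have FE v : linfun F v = f v by rewrite lfunE.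
exists (linfun F @: U)%VS.
  rewrite -dimU; apply: limg_dim_eq.
  suff /eqP -> : lker (linfun F) == 0%VS by rewrite capv0.
  by apply/lker0P => v w; rewrite !FE => /inj_f.
move=> w; rewrite TE; split=> [/memv_imgP[v /US Sv ->]|[v /US Uv ->]].
  by exists v; rewrite ?FE.
by rewrite -FE memv_img.
Qed.

Lemma has_dim_uniq (V : vectType K) (S : V -> Prop) d e :
  has_dim S d -> has_dim S e -> d = e.
Proof.
case=> U <- US [W <- WS]; congr (\dim _); apply/vspaceP => v.
by apply/idP/idP => [/US/WS|/WS/US].
Qed.

Lemma eq_has_dim (V : vectType K) (S T : V -> Prop) d :
  (forall v, S v <-> T v) -> has_dim S d -> has_dim T d.
Proof. by move=> ST [U dimU US]; exists U => // v; rewrite US. Qed.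

End Dimension.

(** * Gaussian elimination over the integers *)

Section Elimination.

Fixpoint lincomb (a : Z) (r : seq Z) (b : Z) (s : seq Z) : seq Z :=
  match r, s with
  | x :: r', y :: s' => (a * x + b * y)%Zc :: lincomb a r' b s'
  | [::], _ => [seq (b * y)%Zc | y <- s]
  | _, [::] => [seq (a * x)%Zc | x <- r]
  end.

(* A divisor of 6 ^ 30; 0 is not one because x mod 0 = x. *)
Definition six_unit (p : Z) : bool := Z.eqb ((6 ^ 30) mod p)%Zc 0%Zc.

(** Fraction-free: [r] is multiplied by the pivot instead of dividing [r0] by it. The pivot row
    itself reduces to zero and is then discarded through [nonzero]. *)
Definition reduce (r0 r : seq Z) : seq Z :=
  if Z.eqb (head 0%Zc r) 0%Zc then behead r
  else lincomb (head 0%Zc r0) (behead r) (- head 0%Zc r) (behead r0).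

Definition nonzero (r : seq Z) := has (fun x => ~~ Z.eqb x 0%Zc) r.

(* [None] when the first column is not zero but contains no admissible pivot. *)
Fixpoint nullity (N : nat) (rows : seq (seq Z)) : option nat :=
  if N is N'.+1 then
    if [seq r <- rows | six_unit (head 0%Zc r)] is r0 :: _ then
      nullity N' [seq r <- [seq reduce r0 r | r <- rows] | nonzero r]
    else if all (fun r => Z.eqb (head 0%Zc r) 0%Zc) rows
      then omap S (nullity N' [seq behead r | r <- rows])
    else None
  else Some 0%N.

Lemma nth_lincomb a r b s j :
  nth 0%Zc (lincomb a r b s) j = (a * nth 0%Zc r j + b * nth 0%Zc s j)%Zc.
Proof.
have nth_scale c (q : seq Z) i :
    nth 0%Zc [seq (c * y)%Zc | y <- q] i = (c * nth 0%Zc q i)%Zc.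
  case: (ltnP i (size q)) => iq; first by rewrite (nth_map 0%Zc).
  by rewrite !nth_default ?size_map //; lia.
elim: r s j => [|x r IHr] s j.
  by rewrite [LHS]nth_scale nth_nil; lia.
case: s => [|y s]; first by rewrite [LHS]nth_scale nth_nil; lia.
by case: j => //= j; rewrite IHr.
Qed.

Variable K : fieldType.
Definition ZK (z : Z) : K := (int_of_Z z)%:~R.

Lemma ZKD a b : ZK (a + b)%Zc = ZK a + ZK b.
Proof. by rewrite /ZK -intrD; congr (_%:~R); lia. Qed.

Lemma ZKM a b : ZK (a * b)%Zc = ZK a * ZK b.
Proof. by rewrite /ZK -intrM; congr (_%:~R); lia. Qed.

Lemma ZKN a : ZK (- a)%Zc = - ZK a.
Proof. by rewrite /ZK -intrN; congr (_%:~R); lia. Qed.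

Hypothesis K2 : (2%:R : K) != 0.
Hypothesis K3 : (3%:R : K) != 0.

Lemma ZK_six_unit p : six_unit p -> ZK p != 0.
Proof.
move=> /Z.eqb_spec p6; apply/eqP => p0.
have [p_eq0|p_neq0] := Z.eq_dec p 0.
  by move: p6; rewrite p_eq0.
have [q qE] : exists q, (6 ^ 30)%Zc = (p * q)%Zc.
  by exists (6 ^ 30 / p)%Zc; have := Z.div_mod (6 ^ 30) p p_neq0; lia.
have /eqP : ZK (6 ^ 30) = 0 by rewrite qE ZKM p0 mul0r.
have ZKX k : ZK (iter k (Z.mul 6) 1%Zc) = (2%:R * 3%:R) ^+ k.
  by elim: k => [|k IHk] //; rewrite iterS ZKM IHk exprS -natrM.
rewrite [(6 ^ 30)%Zc](_ : _ = iter 30 (Z.mul 6) 1%Zc) // ZKX.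
by rewrite expf_eq0 /= mulf_eq0 (negPf K2) (negPf K3).
Qed.

Definition solves N (rows : seq (seq Z)) (v : 'rV[K]_N) :=
  forall r, r \in rows -> \sum_(j < N) ZK (nth 0%Zc r j) * v 0 j = 0.

Definition cons_row N (a : K) (w : 'rV[K]_N) : 'rV[K]_N.+1 :=
  \row_j oapp (w 0) a (unlift ord0 j).

Lemma cons_row0 N a (w : 'rV[K]_N) : cons_row a w 0 ord0 = a.
Proof. by rewrite mxE unlift_none. Qed.

Lemma cons_rowS N a (w : 'rV[K]_N) j : cons_row a w 0 (lift ord0 j) = w 0 j.
Proof. by rewrite mxE liftK. Qed.

Lemma cons_rowP N (v : 'rV[K]_N.+1) :
  v = cons_row (v 0 ord0) (\row_j v 0 (lift ord0 j)).
Proof.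
apply/rowP => j; rewrite [RHS]mxE.
by case: unliftP => [k ->|->] //=; rewrite mxE.
Qed.

Lemma cons_row_linear N (h : 'rV[K]_N -> K) :
  (forall a x y, h (a *: x + y) = a * h x + h y) ->
  linear (fun w => cons_row (h w) w).
Proof.
move=> lin_h a x y; apply/rowP => j; rewrite !mxE.
by case: unliftP => [k _|_] /=; rewrite ?mxE.
Qed.

(** A zero column leaves its unknown unconstrained: the solution space gains the line of the first
    basis vector as a direct summand. *)
Lemma has_dim_cons N (S : 'rV[K]_N -> Prop) d :
  has_dim S d ->
  has_dim (fun v : 'rV[K]_N.+1 => S (\row_j v 0 (lift ord0 j))) d.+1.
Proof.
pose f (w : 'rV[K]_N) := cons_row 0 w.
have lin_f : linear f by apply: cons_row_linear => *; rewrite mulr0 addr0.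
have inj_f : injective f.
  by move=> w w' /rowP eq_f; apply/rowP => j; have := eq_f (lift ord0 j);
    rewrite !cons_rowS.
move=> dimS.
have [U dimU UE] := has_dim_image (T := fun v => exists2 w, S w & v = f w)
  lin_f inj_f (fun _ => iff_refl _) dimS.
pose e : 'rV[K]_N.+1 := cons_row 1 0.
have e_neq0 : e != 0.
  apply/eqP => /rowP/(_ ord0); rewrite cons_row0 mxE => /eqP.
  by rewrite oner_eq0.
have Ue0 : (<[e]> :&: U = 0)%VS.
  apply/eqP; rewrite -subv0; apply/subvP => v.
  rewrite memv_cap memv0 => /andP[/vlineP[a ->] /UE[w _ /rowP/(_ ord0)]].
  by rewrite mxE !cons_row0 mulr1 => ->; rewrite scale0r.
exists (<[e]> + U)%VS.
  by rewrite dimv_disjoint_sum // dim_vline e_neq0 dimU.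
move=> v; split.
  case/memv_addP => _ /vlineP[a ->] [_ /UE[w Sw ->] ->].
  rewrite (_ : \row__ _ = w) //; apply/rowP => j.
  by rewrite 3!mxE !cons_rowS mxE mulr0 add0r.
move=> Sv; rewrite [v]cons_rowP.
have -> : cons_row (v 0 ord0) (\row_j v 0 (lift ord0 j)) =
    v 0 ord0 *: e + f (\row_j v 0 (lift ord0 j)).
  apply/rowP => j; rewrite !mxE.
  by case: unliftP => [k _|_] /=; rewrite ?mxE /=; ring.
apply: memv_add; first exact/vlineP/ex_intro.
by apply/UE; exists (\row_j v 0 (lift ord0 j)).
Qed.

(** Induction on the number of unknowns. The pivot, invertible in [K], expresses the first unknown
    as a linear function [h] of the others, so the solutions form the graph of [h] over the
    solutions of the reduced system. *)
Lemma nullityP N rows d :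
  nullity N rows = Some d -> has_dim (@solves N rows) d.
Proof.
elim: N rows d => [|N IHN] rows d.
  case=> <-; exists 0%VS; first exact: dimv0.
  move=> v; rewrite memv0; split=> [_ r _|_]; first by rewrite big_ord0.
  by apply/eqP/rowP; case.
rewrite [nullity _ _]/=.
have dotE r a (w : 'rV[K]_N) :
    \sum_(j < N.+1) ZK (nth 0%Zc r j) * cons_row a w 0 j =
    ZK (head 0%Zc r) * a + \sum_(j < N) ZK (nth 0%Zc (behead r) j) * w 0 j.
  rewrite big_ord_recl cons_row0 nth0; congr (_ + _).
  by apply: eq_bigr => j _; rewrite cons_rowS nth_behead.
case pivot : [seq r <- rows | _] => [|r0 rs]; last first.
  have : r0 \in [seq r <- rows | six_unit (head 0%Zc r)].
    by rewrite pivot mem_head.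
  rewrite mem_filter => /andP[p0 r0_in].
  have {}p0 := ZK_six_unit p0.
  set p := ZK _ in p0.
  pose h (w : 'rV[K]_N) :=
    - p^-1 * \sum_(j < N) ZK (nth 0%Zc (behead r0) j) * w 0 j.
  move/IHN; apply: (@has_dim_image _ _ _ _ _ _ (fun w => cons_row (h w) w)).
  - apply: cons_row_linear => a x y; rewrite /h.
    under eq_bigr do rewrite mxE mxE mulrDr mulrCA.
    by rewrite big_split -mulr_sumr /=; ring.
  - move=> w w' /rowP eq_f; apply/rowP => j; have := eq_f (lift ord0 j).
    by rewrite !cons_rowS.
  (* The scalar on the right is [p] when [reduce] only drops the leading 0, and 1 otherwise. It is a
     unit in both cases, so an equation and its reduction are equivalent once the first unknown is
     [h w]. *)
  have reduceE r (w : 'rV[K]_N) :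
      p * (ZK (head 0%Zc r) * h w
           + \sum_(j < N) ZK (nth 0%Zc (behead r) j) * w 0 j)
      = (if Z.eqb (head 0%Zc r) 0%Zc then p else 1) *
        \sum_(j < N) ZK (nth 0%Zc (reduce r0 r) j) * w 0 j.
    rewrite /reduce; case: Z.eqb_spec => [->|_].
      by rewrite mul0r add0r.
    under [in RHS]eq_bigr do rewrite nth_lincomb ZKD !ZKM ZKN mulrDl -!mulrA.
    rewrite big_split -!mulr_sumr /= -/p /h; field.
    by [].
  move=> v; split=> [sol_v|[w sol_w ->] r r_in].
    have v0 : v 0 ord0 = h (\row_j v 0 (lift ord0 j)).
      have := sol_v _ r0_in; rewrite [v]cons_rowP dotE => /eqP.
      rewrite addr_eq0 => /eqP vE; rewrite -cons_rowP /h.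
      by rewrite -[\sum_(j < N) _]opprK -vE; field.
    exists (\row_j v 0 (lift ord0 j)); last by rewrite -v0 -cons_rowP.
    move=> r; rewrite mem_filter => /andP[_ /mapP[r1 r1_in ->]].
    have := sol_v _ r1_in; rewrite [v]cons_rowP dotE {1}v0 => sol_r1.
    have /esym/eqP := reduceE r1 (\row_j v 0 (lift ord0 j)).
    rewrite -cons_rowP in sol_r1 *.
    rewrite sol_r1 mulr0 mulf_eq0; case/orP => [|/eqP //].
    by case: ifP => _; rewrite ?(negPf p0) ?oner_eq0.
  apply: (mulfI p0); rewrite dotE reduceE mulr0.
  have [nz|z] := boolP (nonzero (reduce r0 r)).
    by rewrite sol_w ?mulr0 // mem_filter nz map_f.
  rewrite big1 ?mulr0 // => j _.
  rewrite (_ : nth _ _ _ = 0%Zc) ?mul0r //.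
  case: (ltnP j (size (reduce r0 r))) => js; last by rewrite nth_default.
  move: z; rewrite -all_predC => /(all_nthP 0%Zc)/(_ _ js) /=.
  by rewrite negbK => /Z.eqb_spec.
case: ifP => // /allP head0.
case nE : nullity => [e|] //= [<-].
apply: eq_has_dim (has_dim_cons (IHN _ _ nE)) => v; split=> sol_v r.
  move=> r_in; rewrite [v]cons_rowP dotE.
  have /Z.eqb_spec -> := head0 r r_in.
  by rewrite mul0r add0r sol_v ?map_f.
case/mapP => r1 r1_in ->; have := sol_v _ r1_in.
rewrite big_ord_recl nth0; have /Z.eqb_spec -> := head0 r1 r1_in.
rewrite mul0r add0r => sol_r1; rewrite -[RHS]sol_r1.
by apply: eq_bigr => j _; rewrite mxE nth_behead.
Qed.

End Elimination.

(** * Multilinear conditions on an operator *)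

Inductive expr :=
  | Var of nat | Mul of expr & expr | App of expr | Sub of expr & expr.

(** To be read as [e] being free of the variable [i], not as [i] being a free variable of [e]. *)
Fixpoint free i e :=
  match e with
  | Var j => i != j
  | Mul a b | Sub a b => free i a && free i b
  | App a => free i a
  end.

Fixpoint linear_in i e :=
  match e with
  | Var j => i == j
  | Mul a b => linear_in i a && free i b || free i a && linear_in i b
  | Sub a b => linear_in i a && linear_in i b
  | App a => linear_in i a
  end.

Fixpoint operator_free e :=
  match e with
  | Var _ => true
  | Mul a b | Sub a b => operator_free a && operator_free b
  | App _ => false
  end.

Fixpoint operator_linear e :=
  match e with
  | Var _ => false
  | Mul a b => operator_linear a && operator_free b
               || operator_free a && operator_linear b
  | Sub a b => operator_linear a && operator_linear b
  | App a => operator_free a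
  end.

Fixpoint bounded m e :=
  match e with
  | Var i => (i < m)%N
  | Mul a b | Sub a b => bounded m a && bounded m b
  | App a => bounded m a
  end.

(** Each summand contains the operator exactly once, so the condition is a linear system in the
    operator. The alternative [free i e] admits identities in only two variables. *)
Definition multilinear e :=
  [&& operator_linear e, bounded 3 e
    & all (fun i => linear_in i e || free i e) (iota 0 3)].

Section Expressions.
Variable K : fieldType.
Implicit Types (t u : table K) (D : 'M[K]_5) (x : nat -> 'rV[K]_5).

Fixpoint eval t D x e : 'rV[K]_5 :=
  match e with
  | Var i => x i
  | Mul a b => table_mul t (eval t D x a) (eval t D x b)
  | App a => eval t D x a *m D
  | Sub a b => eval t D x a - eval t D x b
  end.

Definition holds t e D := forall x, eval t D x e = 0.

Definition upd x i v : nat -> 'rV[K]_5 := fun j => if j == i then v else x j.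

Lemma eval_ext t D x y e :
  (forall i, ~~ free i e -> x i = y i) -> eval t D x e = eval t D y e.
Proof.
elim: e => /= [i|a IHa b IHb|a IHa|a IHa b IHb] eq_xy.
- by rewrite eq_xy // negbK.
- rewrite IHa => [|i fi]; last by rewrite eq_xy // negb_and fi.
  by rewrite IHb // => i fi; rewrite eq_xy // negb_and fi orbT.
- by rewrite IHa.
- rewrite IHa => [|i fi]; last by rewrite eq_xy // negb_and fi.
  by rewrite IHb // => i fi; rewrite eq_xy // negb_and fi orbT.
Qed.

(** Conjugation by the isomorphism maps the solutions for [t] bijectively onto those for [u]:
    evaluating the conjugate operator at the images of the variables gives the image of the original
    value. *)
Lemma holds_isomorphic t u e d :
    isomorphic t u -> has_dim (holds t e) d -> has_dim (holds u e) d.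
Proof.
case=> f [bij_f fM]; have [g [fK gK gM]] := isomorphic_inv bij_f fM.
pose P := lin1_mx f; pose Q := lin1_mx g.
have fE v : v *m P = f v by rewrite mul_rV_lin1.
have gE v : v *m Q = g v by rewrite mul_rV_lin1.
have PQ : P *m Q = 1%:M.
  by apply/row_matrixP => i; rewrite !rowE mulmxA fE gE fK mulmx1.
have QP : Q *m P = 1%:M.
  by apply/row_matrixP => i; rewrite !rowE mulmxA gE fE gK mulmx1.
have evalE D x : eval u (Q *m D *m P) (f \o x) e = f (eval t D x e).
  elim: e => //= [a -> b ->|a ->|a -> b ->]; rewrite ?fM ?linearB //.
  by rewrite -!fE !mulmxA -[_ *m P *m Q]mulmxA PQ mulmx1.
have PQK D : P *m (Q *m D *m P) *m Q = D.
  by rewrite !mulmxA PQ mul1mx -mulmxA PQ mulmx1.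
have QPK D : Q *m (P *m D *m Q) *m P = D.
  by rewrite !mulmxA QP mul1mx -mulmxA QP mulmx1.
apply: (@has_dim_image _ _ _ _ _ _ (fun D => Q *m D *m P)).
- by move=> a D D'; rewrite mulmxDr mulmxDl -scalemxAr -scalemxAl.
- exact: (can_inj (g := fun D => P *m D *m Q)) PQK.
move=> D; split=> [uD|[D' tD ->] x].
  exists (P *m D *m Q) => // x; apply: (can_inj fK).
  by rewrite -evalE QPK uD linear0.
have := evalE D' (g \o x); rewrite tD linear0 => <-.
by apply: eval_ext => i _ /=; rewrite gK.
Qed.

Lemma eval_free t D x i v e : free i e -> eval t D (upd x i v) e = eval t D x e.
Proof.
move=> fi; apply: eval_ext => j fj; rewrite /upd.
by case: eqP fj => // ->; rewrite fi.
Qed.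

Lemma eval_linear t D x i e a v w : linear_in i e ->
  eval t D (upd x i (a *: v + w)) e =
  a *: eval t D (upd x i v) e + eval t D (upd x i w) e.
Proof.
elim: e => [j /eqP <-|b IHb c IHc|b IHb|b IHb c IHc] /=.
- by rewrite /upd !eqxx.
- case/orP => /andP[].
    by move=> /IHb -> fc; rewrite !(eval_free _ _ _ _ fc) table_mulPl.
  by move=> fb /IHc ->; rewrite !(eval_free _ _ _ _ fb) table_mulPr.
- by move=> /IHb ->; rewrite mulmxDl -scalemxAl.
- by case/andP => /IHb -> /IHc ->; rewrite scalerBr opprD addrACA.
Qed.

Lemma eval_basis_var t D x i e : linear_in i e || free i e ->
  (forall j : 'I_5, eval t D (upd x i (n j.+1)) e = 0) -> eval t D x e = 0.
Proof.
case/orP => [li|fi] tD; last by rewrite -(eval_free t D x (n 1) fi) (tD 0).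
have eval0 : eval t D (upd x i 0) e = 0.
  have := eval_linear t D x (-1) 0 0 li.
  by rewrite scaler0 addr0 scaleN1r addNr.
have -> : eval t D x e = eval t D (upd x i (x i)) e.
  by apply: eval_ext => j _; rewrite /upd; case: eqP => [->|].
rewrite [x i]vec_sum; elim/big_ind: _ => // [v w v0 w0|j _].
  by rewrite -[v]scale1r eval_linear // v0 w0 scaler0 addr0.
by rewrite -[_ *: _]addr0 eval_linear // tD scaler0 add0r.
Qed.

Lemma bounded_free m i e : bounded m e -> ~~ free i e -> (i < m)%N.
Proof.
elim: e => /= [j jm|a IHa b IHb|a IHa|a IHa b IHb] //.
- by rewrite negbK => /eqP ->.
- by case/andP=> /IHa Ha /IHb Hb; rewrite negb_and => /orP[/Ha|/Hb].
- by case/andP=> /IHa Ha /IHb Hb; rewrite negb_and => /orP[/Ha|/Hb].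
Qed.

Lemma holds_basis t D e : multilinear e ->
  holds t e D <-> forall i j k : 'I_5,
    eval t D (fun l => n (nth 0%N [:: i.+1; j.+1; k.+1] l)) e = 0.
Proof.
case/and3P => _ e3 /and4P[e0 e1 e2 _]; split=> [tD *|tD]; first exact: tD.
move=> x; apply: (eval_basis_var e0) => i; apply: (eval_basis_var e1) => j.
apply: (eval_basis_var e2) => k; rewrite -[RHS](tD i j k).
by apply: eval_ext => l /(bounded_free e3); case: l => [|[|[|]]].
Qed.

Lemma eval_operator_free t D D' x e :
  operator_free e -> eval t D x e = eval t D' x e.
Proof.
by elim: e => //= a IHa b IHb /andP[/IHa -> /IHb ->].
Qed.

Lemma eval_operator_linear t c D D' x e : operator_linear e ->
  eval t (c *: D + D') x e = c *: eval t D x e + eval t D' x e.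
Proof.
elim: e => //= [a IHa b IHb|a _|a IHa b IHb].
- case/orP => /andP[].
    move=> /IHa -> fb; rewrite table_mulPl.
    by rewrite !(eval_operator_free _ (c *: D + D') D' _ fb)
      (eval_operator_free _ D D' _ fb).
  move=> fa /IHb ->; rewrite table_mulPr.
  by rewrite !(eval_operator_free _ (c *: D + D') D' _ fa)
    (eval_operator_free _ D D' _ fa).
- move=> fa; rewrite mulmxDr -scalemxAr.
  by rewrite (eval_operator_free _ (c *: D + D') D' _ fa)
    (eval_operator_free _ D D' _ fa).
- by case/andP => /IHa -> /IHb ->; rewrite scalerBr opprD addrACA.
Qed.

(** The values at the elementary matrices are the coefficients of the linear system whose unknowns
    are the 25 entries of [D]. *)
Lemma eval_operator_sum t D x e : operator_linear e ->
  eval t D x e = \sum_(a < 5) \sum_(b < 5) D a b *: eval t (delta_mx a b) x e.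
Proof.
move=> De; have eval0 : eval t 0 x e = 0.
  have := eval_operator_linear t (-1) 0 0 x De.
  by rewrite scaler0 addr0 scaleN1r addNr.
have evalD E F : eval t (E + F) x e = eval t E x e + eval t F x e.
  by rewrite -[E]scale1r eval_operator_linear // !scale1r.
have evalZ c E : eval t (c *: E) x e = c *: eval t E x e.
  by rewrite -[_ *: E]addr0 eval_operator_linear // eval0 addr0.
rewrite {1}[D]matrix_sum_delta (big_morph (fun E => eval t E x e) evalD eval0).
apply: eq_bigr => a _; rewrite (big_morph (fun E => eval t E x e) evalD eval0).
by apply: eq_bigr => b _; rewrite evalZ.
Qed.

End Expressions.

(* [(k, z)] stands for the term [z *: n k]; repetitions are allowed. *)
Definition zvector := seq (nat * Z).
Definition ztable := seq ((nat * nat) * zvector).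

Definition zmul (T : ztable) (u v : zvector) : zvector :=
  flatten [seq flatten [seq
    flatten [seq [seq (r.1, (p.2 * q.2 * r.2)%Zc) | r <- e.2]
            | e <- T & (e.1 == (p.1, q.1)) || (e.1 == (q.1, p.1))]
    | q <- v] | p <- u].

(** Here the operator is the elementary matrix at row [a] and column [b], counted from 0. Matrices
    act on row vectors from the right, so it sends n_(a+1) to n_(b+1) and the other basis vectors to
    0. *)
Fixpoint zeval (T : ztable) (a b : nat) (s : seq nat) e : zvector :=
  match e with
  | Var i => [:: (nth 0%N s i, 1%Zc)]
  | Mul e1 e2 => zmul T (zeval T a b s e1) (zeval T a b s e2)
  | App e1 => [seq (b.+1, p.2) | p <- zeval T a b s e1 & p.1 == a.+1]
  | Sub e1 e2 =>
      zeval T a b s e1 ++ [seq (p.1, (- p.2)%Zc) | p <- zeval T a b s e2]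
  end.

Definition zco (u : zvector) (k : nat) : Z :=
  foldr (fun p c => if p.1 == k then (p.2 + c)%Zc else c) 0%Zc u.

(* The rows of D are taken in decreasing order: in increasing order a column is
   met in which 5 is the only entry, for the derivations of J17. *)
Definition equations (T : ztable) e : seq (seq Z) :=
  flatten [seq [seq r <- [seq [seq zco v k | v <- vs] | k <- iota 1 5]
               | nonzero r]
    | vs <- [seq [seq zeval T a b s e | a <- rev (iota 0 5), b <- iota 0 5]
            | s <- [seq [:: i; jk.1; jk.2] | i <- iota 1 5,
                jk <- [seq (j, k) | j <- iota 1 5,
                         k <- iota 1 (if free 2 e then 1 else 5)]]]].

Definition holds_dim (T : ztable) e : option nat := nullity 25 (equations T e).

(** * Correctness of the integral computation *)

Section IntegralTables.
Variable K : fieldType.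

Definition vec (u : zvector) : 'rV[K]_5 := \sum_(p <- u) ZK K p.2 *: n p.1.

Definition of_ztable (T : ztable) : table K := [seq (e.1, vec e.2) | e <- T].

Definition valid (T : ztable) :=
  all (fun e : (nat * nat) * zvector =>
    (0 < e.1.1 <= 5)%N && (0 < e.1.2 <= 5)%N) T.

Lemma of_ztable_basis T i j : valid T ->
  table_mul (of_ztable T) (n i) (n j) =
  \sum_(e <- T | (e.1 == (i, j)) || (e.1 == (j, i))) vec e.2.
Proof.
move=> vT; rewrite mulE big_map [RHS]big_mkcond /=.
rewrite big_seq [RHS]big_seq; apply: eq_bigr => -[[a b] w] /=.
move=> /(allP vT)/andP[/= aP bP]; rewrite /pairing /= !co_n //.
rewrite !xpair_eqE [a == i]eq_sym [a == j]eq_sym [b == i]eq_sym [b == j]eq_sym.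
case: eqP => [<-|/eqP neq_ab].
  by rewrite [(j == a) && _]andbC orbb -natrM mulnb; case: andb;
    rewrite ?scale1r ?scale0r.
have : ~~ ((i == a) && (i == b)).
  by apply/negP => /andP[/eqP ia /eqP ib]; rewrite -ia -ib eqxx in neq_ab.
case: (i == a); case: (i == b); case: (j == a); case: (j == b) => //= _;
  by rewrite ?mulr1 ?mulr0 ?addr0 ?add0r ?scale1r ?scale0r.
Qed.

Lemma table_mul_suml t (I : Type) (r : seq I) (F : I -> 'rV[K]_5) y :
  table_mul t (\sum_(i <- r) F i) y = \sum_(i <- r) table_mul t (F i) y.
Proof.
apply: (big_morph (fun x => table_mul t x y)) => [u v|].
  by rewrite -[u]scale1r table_mulPl !scale1r.
exact: table_mul0l.
Qed.

Lemma table_mul_sumr t (I : Type) (r : seq I) (F : I -> 'rV[K]_5) y :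
  table_mul t y (\sum_(i <- r) F i) = \sum_(i <- r) table_mul t y (F i).
Proof.
by rewrite table_mulC table_mul_suml; apply: eq_bigr => i _; rewrite table_mulC.
Qed.

Lemma vec_zmul T u v : valid T ->
  vec (zmul T u v) = table_mul (of_ztable T) (vec u) (vec v).
Proof.
move=> vT; rewrite /zmul /vec big_flatten big_map table_mul_suml.
apply: eq_bigr => p _; rewrite big_flatten big_map table_mul_sumr.
apply: eq_bigr => q _; rewrite big_flatten big_map big_filter.
rewrite table_mulZl table_mulZr of_ztable_basis // !scaler_sumr.
apply: eq_bigr => e _; rewrite big_map /vec !scaler_sumr.
by apply: eq_bigr => r _; rewrite !ZKM !scalerA.
Qed.

Lemma n_delta i (a b : 'I_5) :
  n i *m delta_mx a b = (i == a.+1)%:R *: n b.+1 :> 'rV[K]_5.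
Proof.
apply/rowP => k; rewrite mxE (bigD1 a) //= big1 => [|c /negPf ca].
  rewrite !mxE eqxx addr0 /= [a.+1 == i]eq_sym.
  by rewrite -(inj_eq val_inj) eqSS.
by rewrite !mxE ca mulr0.
Qed.

Lemma vec_zeval T (a b : 'I_5) s e : valid T ->
  vec (zeval T a b s e) =
  eval (of_ztable T) (delta_mx a b) (fun i => n (nth 0%N s i)) e.
Proof.
move=> vT; elim: e => /= [i|e IHe e' IHe'|e IHe|e IHe e' IHe'].
- by rewrite /vec big_seq1 scale1r.
- by rewrite vec_zmul // IHe IHe'.
- rewrite -IHe /vec mulmx_suml big_map big_filter big_mkcond.
  apply: eq_bigr => p _; rewrite -scalemxAl n_delta.
  by case: ifP => _; rewrite ?scale1r ?scale0r ?scaler0.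
- rewrite -IHe -IHe' /vec big_cat big_map -sumrN; congr (_ + _).
  by apply: eq_bigr => p _; rewrite ZKN scaleNr.
Qed.

Lemma co_vec u k : (0 < k <= 5)%N -> co (vec u) k = ZK K (zco u k).
Proof.
move=> kP; rewrite /vec co_sum.
elim: u => [|p u IHu]; first by rewrite big_nil.
rewrite big_cons IHu /= coZ co_n //; case: eqP => _.
  by rewrite mulr1 ZKD.
by rewrite mulr0 add0r.
Qed.

(** [rev_ord] matches the decreasing order of the rows of [D] among the unknowns of [equations]. *)
Definition of_row (v : 'rV[K]_25) : 'M[K]_5 :=
  \matrix_(a, b) v 0 (inord (rev_ord a * 5 + b)).

Lemma of_row_sum (F : nat -> K) :
  \sum_(q < 25) F q = \sum_(a < 5) \sum_(b < 5) F (rev_ord a * 5 + b)%N.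
Proof.
rewrite [RHS](reindex_inj rev_ord_inj).
under [RHS]eq_bigr => a _ do under eq_bigr => b _ do rewrite rev_ordK.
by rewrite !big_ord_recl !big_ord0 /= !addr0 !addrA.
Qed.

Definition equation (T : ztable) e s k : seq Z :=
  [seq zco v k |
    v <- [seq zeval T a b s e | a <- rev (iota 0 5), b <- iota 0 5]].

Lemma equationE T e s k (v : 'rV[K]_25) :
  valid T -> operator_linear e -> (0 < k <= 5)%N ->
  \sum_(q < 25) ZK K (nth 0%Zc (equation T e s k) q) * v 0 q =
  co (eval (of_ztable T) (of_row v) (fun i => n (nth 0%N s i)) e) k.
Proof.
move=> vT De kP; rewrite eval_operator_sum // co_sum.
under eq_bigr => q _ do rewrite -[X in v 0 X]inord_val.
rewrite (of_row_sum
  (fun q => ZK K (nth 0%Zc (equation T e s k) q) * v 0 (inord q))).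
apply: eq_bigr => a _; rewrite co_sum; apply: eq_bigr => b _.
rewrite mxE coZ -vec_zeval // co_vec // mulrC; congr (_ * ZK K _).
by case: a b => [[|[|[|[|[|a]]]]] //= _] [[|[|[|[|[|b]]]]] //= _].
Qed.

Lemma equationsP T e (v : 'rV[K]_25) : valid T -> multilinear e ->
  solves (equations T e) v <-> holds (of_ztable T) e (of_row v).
Proof.
move=> vT me; have De : operator_linear e by case/and3P: me.
rewrite holds_basis //; split=> [sol_v i j k'|hold_v r].
  (* The system instantiates an absent third variable by n_1 only; the value does not depend on this
     choice. *)
  pose k : 'I_5 := if free 2 e then 0 else k'.
  have -> : eval (of_ztable T) (of_row v)
      (fun l => n (nth 0%N [:: i.+1; j.+1; k'.+1] l)) e
    = eval (of_ztable T) (of_row v)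
      (fun l => n (nth 0%N [:: i.+1; j.+1; k.+1] l)) e.
    by apply: eval_ext => -[|[|[|l]]] // /negPf nfree; rewrite /k nfree.
  have kP : k.+1 \in iota 1 (if free 2 e then 1 else 5).
    by rewrite /k; case: ifP => // _; rewrite mem_iota; exact: (ltn_ord k').
  apply: vecP => l lP.
  rewrite co0 -(equationE [:: i.+1; j.+1; k.+1] v vT De lP).
  have iP (m : 'I_5) : m.+1 \in iota 1 5.
    by rewrite mem_iota; exact: (ltn_ord m).
  set r := equation _ _ _ _.
  have [nz|z] := boolP (nonzero r); last first.
    rewrite big1 // => q _.
    rewrite (_ : nth _ _ _ = 0%Zc) ?mul0r //.
    case: (ltnP q (size r)) => qs; last by rewrite nth_default.
    move: z; rewrite -all_predC => /(all_nthP 0%Zc)/(_ _ qs) /=.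
    by rewrite negbK => /Z.eqb_spec.
  apply: sol_v; rewrite /equations -map_comp.
  apply/flattenP; exists [seq r <- [seq equation T e [:: i.+1; j.+1; k.+1] l
    | l <- iota 1 5] | nonzero r]; last first.
    by rewrite mem_filter nz map_f // mem_iota.
  apply/mapP; exists [:: i.+1; j.+1; k.+1] => //.
  apply/allpairsPdep; exists i.+1, (j.+1, k.+1); split=> //.
  exact: (allpairs_f pair (iP j) kP).
rewrite /equations -map_comp => /flattenP[_ /mapP[s s_in ->]].
rewrite mem_filter => /andP[_ /mapP[l l_in ->]].
have lP : (0 < l <= 5)%N by move: l_in; rewrite mem_iota.
rewrite [LHS](equationE s v vT De lP).
case/allpairsPdep: s_in => i [jk [i_in jk_in ->]].
case/allpairsPdep: jk_in => j [k [j_in k_in ->]] /=.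
have {}k_in : k \in iota 1 5.
  by move: k_in; rewrite !mem_iota; case: ifP => // _; case: k => [|[|]].
have ordP m : m \in iota 1 5 -> exists m' : 'I_5, m = m'.+1.
  rewrite mem_iota => /andP[m0 m6]; case: m m0 m6 => // m _ m5.
  by exists (Ordinal (m5 : (m < 5)%N)).
have [[i' ->] [j' ->] [k' ->]] :=
  And3 (ordP _ i_in) (ordP _ j_in) (ordP _ k_in).
by rewrite hold_v co0.
Qed.

Hypothesis K2 : (2%:R : K) != 0.
Hypothesis K3 : (3%:R : K) != 0.

Lemma holds_dimP T e d : valid T -> multilinear e -> holds_dim T e = Some d ->
  has_dim (holds (of_ztable T) e) d.
Proof.
move=> vT me; rewrite /holds_dim => dimE.
apply: (has_dim_image (f := of_row)) (@nullityP K K2 K3 25 _ _ dimE).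
- by move=> a v w; apply/matrixP => i j; rewrite !mxE.
- move=> v w /matrixP eq_vw; apply/rowP => q.
  have qP : (q %/ 5 < 5)%N by rewrite ltn_divLR.
  have := eq_vw (rev_ord (Ordinal qP)) (Ordinal (ltn_pmod q (isT : 0 < 5)%N)).
  by rewrite !mxE rev_ordK /= -divn_eq inord_val.
move=> D; split=> [hD|[v sol_v ->]]; last exact/equationsP.
pose v : 'rV[K]_25 := \row_q D (rev_ord (inord (q %/ 5))) (inord (q %% 5)).
have DE : D = of_row v.
  apply/matrixP => a b; rewrite !mxE inordK; last first.
    by rewrite (@leq_trans (4 * 5 + 5)) // -addnS leq_add ?leq_mul // -ltnS.
  by rewrite divnMDl // modnMDl divn_small // modn_small // addn0 !inord_val
    rev_ordK.
by exists v => //; apply/equationsP; rewrite -?DE.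
Qed.

End IntegralTables.

(** * The algebras with dim A^2 = 3 and dim A^3 = 1 *)

Section Forms.
Variable K : fieldType.
Implicit Types (x y : 'rV[K]_5).

(* Locked, so that [coE] does not see the underlying sum. *)
Definition vec5 (a b c d e : K) : 'rV[K]_5 :=
  locked (a *: n 1 + b *: n 2 + c *: n 3 + d *: n 4 + e *: n 5).

Lemma co_vec5 a b c d e :
  ((co (vec5 a b c d e) 1 = a) * (co (vec5 a b c d e) 2 = b)
   * (co (vec5 a b c d e) 3 = c) * (co (vec5 a b c d e) 4 = d)
   * (co (vec5 a b c d e) 5 = e))%type.
Proof. by rewrite /vec5 -lock; do ![split]; rewrite !coE !co_n //=; ring. Qed.

(* [double_form] and [split_form]: with V spanned by n_1 and n_2, the kernel of
   S^2 V -> A^2 / A^3 is spanned by n_2^2, respectively by n_1 n_2. *)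
Definition double_form (a b c d e : K) : table K :=
  [:: ((1%N, 1%N), n 3); ((1%N, 2%N), n 4); ((1%N, 3%N), a *: n 5);
      ((2%N, 3%N), b *: n 5); ((1%N, 4%N), c *: n 5); ((2%N, 4%N), d *: n 5);
      ((2%N, 2%N), e *: n 5)].

Definition split_form (f b c e : K) : table K :=
  [:: ((1%N, 1%N), n 3); ((2%N, 2%N), n 4); ((1%N, 3%N), f *: n 5);
      ((1%N, 4%N), b *: n 5); ((2%N, 3%N), c *: n 5); ((2%N, 4%N), e *: n 5)].

Lemma double_mul a b c d e x y : table_mul (double_form a b c d e) x y =
  vec5 0 0 (co x 1 * co y 1) (co x 1 * co y 2 + co x 2 * co y 1)
    (a * (co x 1 * co y 3 + co x 3 * co y 1)
     + b * (co x 2 * co y 3 + co x 3 * co y 2)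
     + c * (co x 1 * co y 4 + co x 4 * co y 1)
     + d * (co x 2 * co y 4 + co x 4 * co y 2) + e * (co x 2 * co y 2)).
Proof.
rewrite mulE !big_cons big_nil /pairing /=.
by apply: vecP5; rewrite !co_vec5 !coE !co_n //=; split; ring.
Qed.

Lemma split_mul f b c e x y : table_mul (split_form f b c e) x y =
  vec5 0 0 (co x 1 * co y 1) (co x 2 * co y 2)
    (f * (co x 1 * co y 3 + co x 3 * co y 1)
     + b * (co x 1 * co y 4 + co x 4 * co y 1)
     + c * (co x 2 * co y 3 + co x 3 * co y 2)
     + e * (co x 2 * co y 4 + co x 4 * co y 2)).
Proof.
rewrite mulE !big_cons big_nil /pairing /=.
by apply: vecP5; rewrite !co_vec5 !coE !co_n //=; split; ring.
Qed.

End Forms.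

Ltac table_eval :=
  rewrite ?double_mul ?split_mul ?mulE ?big_cons ?big_nil /pairing /=;
  rewrite ?co_vec5 ?coE ?co_vec5 ?co_n //= ?co_vec5.
Ltac vec_eval :=
  cbv beta; apply: vecP5; rewrite ?co_vec5 ?coE ?co_vec5; table_eval.
Ltac iso_by f g :=
  apply: (@isomorphic_of_cancel _ _ _ f g) => [k x y|x|x|x y];
  vec_eval.

(** * The listed algebras in adapted bases *)

Section FormsOfAlgebras.
Variable K : fieldType.

Local Notation relabel i j k l m := (fun x : 'rV[K]_5 =>
  vec5 (co x i) (co x j) (co x k) (co x l) (co x m)).

Lemma eps10_double : isomorphic (alg (eps10 K)) (double_form 1 0 0 0 0).
Proof. iso_by (relabel 1 2 3 5 4) (relabel 1 2 3 5 4); split; ring. Qed.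

Lemma eps8_double : isomorphic (alg (eps8 K)) (double_form 1 0 0 0 1).
Proof. iso_by (relabel 1 2 3 5 4) (relabel 1 2 3 5 4); split; ring. Qed.

Lemma J34_double : isomorphic (alg (J34 K)) (double_form 0 0 1 0 0).
Proof. iso_by (relabel 1 2 5 3 4) (relabel 1 2 4 5 3); split; ring. Qed.

Lemma J39_double : isomorphic (alg (J39 K)) (double_form 0 0 1 0 1).
Proof. iso_by (relabel 1 2 5 3 4) (relabel 1 2 4 5 3); split; ring. Qed.

Lemma J35_double : isomorphic (alg (J35 K)) (double_form 0 0 0 1 0).
Proof. iso_by (relabel 2 1 5 3 4) (relabel 2 1 4 5 3); split; ring. Qed.

Lemma J41_0_double : isomorphic (alg (J41 (0 : K))) (double_form 0 0 1 1 0).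
Proof. iso_by (relabel 1 2 5 3 4) (relabel 1 2 4 5 3); split; ring. Qed.

Lemma eps4_double : isomorphic (alg (eps4 K)) (double_form 0 1 1 0 0).
Proof. iso_by (relabel 1 2 3 4 5) (relabel 1 2 3 4 5); split; ring. Qed.

Lemma J25_double : isomorphic (alg (J25 K)) (double_form 1 (- 2%:R) 1 0 0).
Proof. iso_by (relabel 1 2 3 4 5) (relabel 1 2 3 4 5); split; ring. Qed.

Lemma J29_double : isomorphic (alg (J29 K)) (double_form 0 1 0 0 0).
Proof. iso_by (relabel 1 3 2 5 4) (relabel 1 3 2 5 4); split; ring. Qed.

Lemma eps3_split : isomorphic (alg (eps3 K)) (split_form 1 0 0 1).
Proof. iso_by (relabel 1 4 2 5 3) (relabel 1 3 5 2 4); split; ring. Qed.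

Lemma eps6_split : isomorphic (alg (eps6 K)) (split_form 1 0 0 0).
Proof. iso_by (relabel 1 4 2 5 3) (relabel 1 3 5 2 4); split; ring. Qed.

Lemma J28_split : isomorphic (alg (J28 K)) (split_form 0 0 1 0).
Proof. iso_by (relabel 1 3 2 5 4) (relabel 1 3 2 5 4); split; ring. Qed.

Lemma J23_double (b : K) : isomorphic (alg (J23 b)) (double_form 1 b 0 1 0).
Proof. iso_by (relabel 1 2 3 4 5) (relabel 1 2 3 4 5); split; ring. Qed.

Lemma J24_double (c : K) : isomorphic (alg (J24 c)) (double_form 0 1 c 0 0).
Proof. iso_by (relabel 1 2 3 4 5) (relabel 1 2 3 4 5); split; ring. Qed.

Lemma J26_split (d : K) : isomorphic (alg (J26 d)) (split_form 1 1 0 d).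
Proof. iso_by (relabel 1 2 3 4 5) (relabel 1 2 3 4 5); split; ring. Qed.

Lemma J27_split (e f : K) : isomorphic (alg (J27 e f)) (split_form f 1 1 e).
Proof. iso_by (relabel 1 2 3 4 5) (relabel 1 2 3 4 5); split; ring. Qed.

Lemma split_swap (f b c e : K) :
  isomorphic (split_form f b c e) (split_form e c b f).
Proof. iso_by (relabel 2 1 4 3 5) (relabel 2 1 4 3 5); split; ring. Qed.

(** As n_1 n_3 = n_3^2, the two lines are spanned by n_3 and n_3 - n_1, the images of n_1 and n_2
    under the inverse map. *)
Lemma J30_split : isomorphic (alg (J30 K)) (split_form 0 1 0 1).
Proof.
iso_by (fun x : 'rV[K]_5 => vec5 (co x 1 + co x 3) (- co x 1)
    (co x 2 + co x 5) (co x 2) (co x 4))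
  (fun x : 'rV[K]_5 => vec5 (- co x 2) (co x 4) (co x 1 + co x 2)
    (co x 5) (co x 3 - co x 4)); split; ring.
Qed.

Lemma double_neg (a b c d e : K) :
  isomorphic (double_form a b c d e) (double_form a (- b) (- c) d e).
Proof.
pose f (x : 'rV[K]_5) := vec5 (co x 1) (- co x 2) (co x 3) (- co x 4) (co x 5).
by iso_by f f; split; ring.
Qed.

Lemma split_neg (f b c e : K) :
  isomorphic (split_form f b c e) (split_form f b (- c) (- e)).
Proof.
pose g (x : 'rV[K]_5) := vec5 (co x 1) (- co x 2) (co x 3) (co x 4) (co x 5).
by iso_by g g; split; ring.
Qed.

End FormsOfAlgebras.

Section Isos2.
Variable K : fieldType.
Hypothesis K2 : (2%:R : K) != 0.

Let K4 : (4%:R : K) != 0.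
Proof. by rewrite (natrM _ 2 2) mulf_neq0. Qed.

(** As n_1^2 = n_2^2, the two lines are spanned by n_1 + n_2 and n_2 - n_1. *)
Lemma J37_split : isomorphic (alg (J37 K)) (split_form (-1) 1 1 (-1)).
Proof.
iso_by (fun x : 'rV[K]_5 => vec5 ((co x 1 + co x 2) / 2%:R)
    ((co x 2 - co x 1) / 2%:R) ((co x 5 + co x 3) / 4%:R)
    ((co x 5 - co x 3) / 4%:R) (- (co x 4 / 2%:R)))
  (fun x : 'rV[K]_5 => vec5 (co x 1 - co x 2) (co x 1 + co x 2)
    (2%:R * (co x 3 - co x 4)) (- (2%:R * co x 5))
    (2%:R * (co x 3 + co x 4))); split; field; rewrite ?K2 ?K4 //.
Qed.

(** The lines are spanned by u = n_1 + n_2 and v = n_1 - n_2, and v annihilates A^2, which gives the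
    two zeros. Since u v^2 = - u u^2, the second generator is i v, whose square has the opposite
    sign. *)
Lemma J41_1_split (i : K) : i ^+ 2 = -1 ->
  isomorphic (alg (J41 (1 : K))) (split_form 1 1 0 0).
Proof.
move=> i2.
iso_by (fun x : 'rV[K]_5 => vec5 ((co x 1 + co x 2) / 2%:R)
    (i * ((co x 2 - co x 1) / 2%:R)) ((co x 3 + co x 5) / 4%:R)
    ((co x 3 - co x 5) / 4%:R) (co x 4 / 4%:R))
  (fun x : 'rV[K]_5 => vec5 (co x 1 + i * co x 2) (co x 1 - i * co x 2)
    (2%:R * (co x 3 + co x 4)) (4%:R * co x 5)
    (2%:R * (co x 3 - co x 4))); split; field: i2; rewrite ?K2 ?K4 //.
Qed.

(** The kernel s^2 n_1^2 - n_2^2 factors into u = s n_1 + n_2 and v = s n_1 - n_2. Here u v^2 = - 2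
    s (s + 1) n_4 and v u^2 = 2 s (s - 1) n_4; the generators (s + 1) u and (1 - s) v make these two
    products equal, and their common value is taken as n_5. The remaining coefficients are then
    [param27 s] and its inverse. *)
Lemma J41_split (s : K) : s != 0 -> s ^+ 2 != 1 ->
  isomorphic (alg (J41 (s ^+ 2)))
    (split_form (param27 s)^-1 1 1 (param27 s)).
Proof.
move=> s0; rewrite -subr_eq0 subr_sqr_1 mulf_eq0 negb_or => /andP[sm sp].
have ms : 1 - s != 0 by rewrite -opprB oppr_eq0.
have sm' : -1 + s != 0 by rewrite addrC.
have ps' : 1 + s != 0 by rewrite addrC.
rewrite /param27.
iso_by (fun x : 'rV[K]_5 => vec5 ((co x 1 / s + co x 2) / (2%:R * (s + 1)))
    ((co x 1 / s - co x 2) / (2%:R * (1 - s)))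
    ((co x 5 / s ^+ 2 + co x 3 / s) / (4%:R * (s + 1) ^+ 2))
    ((co x 5 / s ^+ 2 - co x 3 / s) / (4%:R * (s - 1) ^+ 2))
    (- (co x 4 / (2%:R * s * (s + 1) ^+ 2 * (s - 1) ^+ 2))))
  (fun x : 'rV[K]_5 => vec5 (s * ((s + 1) * co x 1 + (1 - s) * co x 2))
    ((s + 1) * co x 1 - (1 - s) * co x 2)
    (2%:R * s * ((s + 1) ^+ 2 * co x 3 - (s - 1) ^+ 2 * co x 4))
    (- (2%:R * s * (s + 1) ^+ 2 * (s - 1) ^+ 2 * co x 5))
    (2%:R * s ^+ 2 * ((s + 1) ^+ 2 * co x 3 + (s - 1) ^+ 2 * co x 4)));
  split; field;
  rewrite ?K2 ?K4 ?s0 ?sm ?sp ?ms ?sm' ?ps' ?oppr_eq0 ?oner_eq0 //;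
  rewrite /= ?expf_neq0 // ?sm' //.
Qed.
End Isos2.

(** * Isomorphisms between the forms *)

Section Equations.
Variable K : fieldType.
Implicit Types (x y : 'rV[K]_5).

Lemma n_neq0 k : (0 < k <= 5)%N -> n k != 0 :> 'rV[K]_5.
Proof.
move=> kP; apply/eqP => /(congr1 (fun v => co v k)).
by rewrite co_n // eqxx co0 => /eqP; rewrite oner_eq0.
Qed.

Lemma linear_bij_neq0 (f : {linear 'rV[K]_5 -> 'rV[K]_5}) v :
  bijective f -> v != 0 -> f v != 0.
Proof.
move=> bij_f; apply: contra_neq => fv0.
by apply: (bij_inj bij_f); rewrite fv0 linear0.
Qed.

Lemma double_iso_images (a b c d e : K) t' (f : {linear 'rV[K]_5 -> 'rV[K]_5}) :
    (forall x y, f (table_mul (double_form a b c d e) x y)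
                 = table_mul t' (f x) (f y)) ->
  let u := f (n 1) in let v := f (n 2) in let w := f (n 5) in
  [/\ f (n 3) = table_mul t' u u, f (n 4) = table_mul t' u v,
      e *: w = table_mul t' v v,
      a *: w = table_mul t' u (table_mul t' u u) /\
      b *: w = table_mul t' v (table_mul t' u u) &
      c *: w = table_mul t' u (table_mul t' u v) /\
      d *: w = table_mul t' v (table_mul t' u v)].
Proof.
move=> fM /=; rewrite -!linearZ -!fM; set t := double_form _ _ _ _ _.
split=> //; try split; congr (f _); rewrite /t; vec_eval; split; ring.
Qed.

Lemma split_iso_images (a b c e : K) t' (f : {linear 'rV[K]_5 -> 'rV[K]_5}) :
    (forall x y, f (table_mul (split_form a b c e) x y)
                 = table_mul t' (f x) (f y)) ->
  let u := f (n 1) in let v := f (n 2) in let w := f (n 5) in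
  [/\ f (n 3) = table_mul t' u u, f (n 4) = table_mul t' v v,
      0 = table_mul t' u v,
      a *: w = table_mul t' u (table_mul t' u u) /\
      b *: w = table_mul t' u (table_mul t' v v) &
      c *: w = table_mul t' v (table_mul t' u u) /\
      e *: w = table_mul t' v (table_mul t' v v)].
Proof.
move=> fM /=; rewrite -!linearZ -!fM -(linear0 f); set t := split_form _ _ _ _.
split=> //; try split; congr (f _); rewrite /t; vec_eval; split; ring.
Qed.

Lemma co_scale_eq0 z (w : 'rV[K]_5) i :
  z != 0 -> co (z *: w) i = 0 -> co w i = 0.
Proof. by move=> /negPf z0 /eqP; rewrite coZ mulf_eq0 z0 => /eqP. Qed.

(** Modulo A^2, the line of n_2 is the only one whose square lies in A^3. Hence the matrix on A /
    A^2 is triangular, with n_1 sent to p n_1 + q n_2 and n_2 to r n_2, while n_5 is scaled by s.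
    The components k and l of the image of n_2 on n_3 and n_4 enter only the equation for e. *)
Lemma double_iso (a b c d e a' b' c' d' e' : K) :
    [|| a != 0, b != 0, c != 0 | d != 0] ->
    isomorphic (double_form a b c d e) (double_form a' b' c' d' e') ->
  exists p q r s k l,
    [/\ [/\ p != 0, r != 0 & s != 0],
        [/\ a * s = p ^+ 3 * a' + p ^+ 2 * q * b' + 2%:R * p ^+ 2 * q * c'
                     + 2%:R * p * q ^+ 2 * d',
            b * s = p ^+ 2 * r * b' + 2%:R * p * q * r * d',
            c * s = p ^+ 2 * r * c' + p * q * r * d'
          & d * s = p * r ^+ 2 * d']
      & e * s = e' * r ^+ 2 + 2%:R * r * (b' * k + d' * l)].
Proof.
move=> nz [f [bij_f fM]].
have [f3 f4 ew [aw bw] [cw dw]] := double_iso_images fM.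
move: f3 f4 ew aw bw cw dw.
set u := f (n 1); set v := f (n 2); set w := f (n 5).
rewrite !double_mul => f3 f4 ew aw bw cw dw.
(* A nonzero structure constant times w is a product of three elements, hence a multiple of n_5. *)
have [w1 w2 w3 w4] : [/\ co w 1 = 0, co w 2 = 0, co w 3 = 0 & co w 4 = 0].
  by case/or4P: nz => z; split; apply: (co_scale_eq0 z);
    rewrite ?aw ?bw ?cw ?dw !co_vec5; ring.
have s0 : co w 5 != 0.
  apply: contra_neq (linear_bij_neq0 bij_f (n_neq0 (isT : 0 < 5 <= 5)%N)) => w5.
  by apply: vecP5; rewrite !co0.
have v1 : co v 1 = 0.
  have /eqP := congr1 (fun v => co v 3) ew.
  by rewrite coZ w3 mulr0 co_vec5 eq_sym mulf_eq0 orbb => /eqP.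
(* Otherwise every vector in the image of f has first coordinate 0. *)
have p0 : co u 1 != 0.
  apply/eqP => u1; case: bij_f => g fK gK.
  suff : co (f (g (n 1))) 1 = 0.
    by rewrite gK co_n // => /eqP; rewrite oner_eq0.
  rewrite [g _]vecE !(linearD, linearZ) /= f3 f4 -/u -/v -/w !coE !co_vec5.
  by rewrite u1 v1 w1; ring.
have r0 : co v 2 != 0.
  apply/eqP => v2.
  have f45 : f (n 4) = f ((co (f (n 4)) 5 / co w 5) *: n 5).
    rewrite linearZ -/w; apply: vecP5.
    rewrite !coZ w1 w2 w3 w4 f4 !co_vec5 v1 v2.
    by split; field.
  have /(congr1 (fun v => co v 4)) := bij_inj bij_f f45.
  by rewrite coZ !co_n // mulr0 => /eqP; rewrite oner_eq0.
exists (co u 1), (co u 2), (co v 2), (co w 5), (co v 3), (co v 4).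
split; first by split.
  split.
  - by rewrite -[LHS]coZ aw !co_vec5; ring.
  - by rewrite -coZ bw !co_vec5 v1; ring.
  - by rewrite -coZ cw !co_vec5 v1; ring.
  - by rewrite -coZ dw !co_vec5 v1; ring.
by rewrite -coZ ew !co_vec5 v1; ring.
Qed.

(** In a split form the square of an element of V is nonzero modulo A^3 unless the element is 0. So
    the image of n_2 would lie in A^2, and that of n_4 = n_1 n_2 in A^3, on the line of the image of
    n_5. *)
Lemma double_split_not_iso (a b c d e f b' c' e' : K) :
    [|| a != 0, b != 0, c != 0 | d != 0] ->
  ~ isomorphic (double_form a b c d e) (split_form f b' c' e').
Proof.
move=> nz [g [bij_g gM]].
have [f3 f4 ew [aw bw] [cw dw]] := double_iso_images gM.
move: f3 f4 ew aw bw cw dw.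
set u := g (n 1); set v := g (n 2); set w := g (n 5).
rewrite !split_mul => f3 f4 ew aw bw cw dw.
have [w1 w2 w3 w4] : [/\ co w 1 = 0, co w 2 = 0, co w 3 = 0 & co w 4 = 0].
  by case/or4P: nz => z; split; apply: (co_scale_eq0 z);
    rewrite ?aw ?bw ?cw ?dw !co_vec5; ring.
have s0 : co w 5 != 0.
  apply: contra_neq (linear_bij_neq0 bij_g (n_neq0 (isT : 0 < 5 <= 5)%N)) => w5.
  by apply: vecP5; rewrite !co0.
have v1 : co v 1 = 0.
  have /eqP := congr1 (fun v => co v 3) ew.
  by rewrite coZ w3 mulr0 co_vec5 eq_sym mulf_eq0 orbb => /eqP.
have v2 : co v 2 = 0.
  have /eqP := congr1 (fun v => co v 4) ew.
  by rewrite coZ w4 mulr0 co_vec5 eq_sym mulf_eq0 orbb => /eqP.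
have f45 : g (n 4) = g ((co (g (n 4)) 5 / co w 5) *: n 5).
  rewrite linearZ -/w; apply: vecP5; rewrite !coZ w1 w2 w3 w4 f4 !co_vec5 v1 v2.
  by split; field.
have /(congr1 (fun v => co v 4)) := bij_inj bij_g f45.
by rewrite coZ !co_n // mulr0 => /eqP; rewrite oner_eq0.
Qed.

(** The relation n_1 n_2 = 0 makes u_1 v_1 and u_2 v_2 vanish for the images u and v of n_1 and n_2.
    The matrix on V is therefore diagonal or antidiagonal, whence the two alternatives. *)
Lemma split_iso (f b c e f' b' c' e' : K) :
    isomorphic (split_form f b c e) (split_form f' b' c' e') ->
    [|| f != 0, b != 0, c != 0 | e != 0] ->
  exists p r s, [/\ p != 0, r != 0 & s != 0] /\
    ([/\ f * s = p ^+ 3 * f', b * s = p * r ^+ 2 * b',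
        c * s = p ^+ 2 * r * c' & e * s = r ^+ 3 * e'] \/
     [/\ f * s = p ^+ 3 * e', b * s = p * r ^+ 2 * c',
        c * s = p ^+ 2 * r * b' & e * s = r ^+ 3 * f']).
Proof.
case=> g [bij_g gM] nz.
have [f3 f4 uv [fw bw] [cw ew]] := split_iso_images gM.
move: f3 f4 uv fw bw cw ew.
set u := g (n 1); set v := g (n 2); set w := g (n 5).
rewrite !split_mul => f3 f4 uv fw bw cw ew.
have [w1 w2 w3 w4] : [/\ co w 1 = 0, co w 2 = 0, co w 3 = 0 & co w 4 = 0].
  by case/or4P: nz => z; split; apply: (co_scale_eq0 z);
    rewrite ?fw ?bw ?cw ?ew !co_vec5; ring.
have s0 : co w 5 != 0.
  apply: contra_neq (linear_bij_neq0 bij_g (n_neq0 (isT : 0 < 5 <= 5)%N)) => w5.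
  by apply: vecP5; rewrite !co0.
have uv1 : co u 1 * co v 1 = 0.
  by have := congr1 (fun v => co v 3) uv; rewrite co0 co_vec5.
have uv2 : co u 2 * co v 2 = 0.
  by have := congr1 (fun v => co v 4) uv; rewrite co0 co_vec5.
have u0 : (co u 1 != 0) || (co u 2 != 0).
  rewrite -negb_and; apply/negP => /andP[/eqP u1 /eqP u2].
  have := linear_bij_neq0 bij_g (n_neq0 (isT : 0 < 3 <= 5)%N).
  rewrite f3; case/eqP; apply: vecP5.
  by rewrite !co_vec5 !co0 u1 u2; split; ring.
have v0 : (co v 1 != 0) || (co v 2 != 0).
  rewrite -negb_and; apply/negP => /andP[/eqP v1 /eqP v2].
  have := linear_bij_neq0 bij_g (n_neq0 (isT : 0 < 4 <= 5)%N).
  rewrite f4; case/eqP; apply: vecP5.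
  by rewrite !co_vec5 !co0 v1 v2; split; ring.
have [u1|u1] := eqVneq (co u 1) 0; last first.
  have v1 : co v 1 = 0 by move/eqP: uv1; rewrite mulf_eq0 (negPf u1) => /eqP.
  have v2 : co v 2 != 0 by move: v0; rewrite v1 eqxx.
  have u2 : co u 2 = 0.
    by move/eqP: uv2; rewrite mulf_eq0 (negPf v2) orbF => /eqP.
  exists (co u 1), (co v 2), (co w 5); split; first by split.
  left; rewrite -![_ * co w 5]coZ fw bw cw ew !co_vec5 u2 v1.
  by split; ring.
have u2 : co u 2 != 0 by move: u0; rewrite u1 eqxx.
have v2 : co v 2 = 0 by move/eqP: uv2; rewrite mulf_eq0 (negPf u2) => /eqP.
have v1 : co v 1 != 0 by move: v0; rewrite v2 eqxx orbF.
exists (co u 2), (co v 1), (co w 5); split; first by split.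
right; rewrite -![_ * co w 5]coZ fw bw cw ew !co_vec5 u1 v2.
by split; ring.
Qed.

End Equations.

(** * Invariants of the forms *)

Section Shapes.
Variable K : fieldType.
Implicit Types a b c d e f s t x y : K.

Lemma scaled_eq0 x y s t :
  s != 0 -> t != 0 -> x * s = t * y -> (x == 0) = (y == 0).
Proof.
move=> /negPf s0 /negPf t0 /(congr1 (fun z => z == 0)).
by rewrite !mulf_eq0 s0 t0 orbF.
Qed.

(* Under an isomorphism d, a d - b c and b - 2 c are rescaled; if d = 0, then so
   are b, c and b + 2 c, and also a when b + 2 c = 0. The values are arbitrary
   names. *)
Definition double_shape a b c d e : nat :=
  if d != 0 then
    if a * d - b * c != 0 then 1%N else if b - 2%:R * c == 0 then 2%N else 3%N
  else if b != 0 then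
    if (b + 2%:R * c == 0) && (a != 0) then 5%N else 4%N
  else if c != 0 then if e == 0 then 6%N else 7%N
  else if e == 0 then 8%N else 9%N.

(** The quantity a d - b c is the determinant of the product of V with A^2 / A^3, and b - 2 c is the
    combination from which the shear q cancels. If d = 0, then q shifts a by a multiple of b + 2 c,
    and k shifts e by a multiple of b, so a matters only if b + 2 c = 0 and e only if b = 0. The
    last two conclusions recover the parameters of J24 and, up to sign, of J23. *)
Lemma double_iso_shape a b c d e a' b' c' d' e' :
    [|| a != 0, b != 0, c != 0 | d != 0] ->
    isomorphic (double_form a b c d e) (double_form a' b' c' d' e') ->
  [/\ double_shape a b c d e = double_shape a' b' c' d' e',
      d = 0 -> b * c' = b' * c
    & d != 0 -> (a * d - b * c) * (b' - 2%:R * c') ^+ 2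
                = (a' * d' - b' * c') * (b - 2%:R * c) ^+ 2].
Proof.
move=> nz /(double_iso nz)
  [p [q [r [s [k [l [[p0 r0 s0] [aE bE cE dE] eE]]]]]]].
have dd : (d == 0) = (d' == 0).
  by apply: (scaled_eq0 s0 _ dE); rewrite mulf_neq0 ?expf_neq0.
have AE : (a * d - b * c) * s ^+ 2 = p ^+ 4 * r ^+ 2 * (a' * d' - b' * c').
  transitivity (a * s * (d * s) - b * s * (c * s)); first by ring.
  by rewrite aE bE cE dE; ring.
have BE : (b - 2%:R * c) * s = p ^+ 2 * r * (b' - 2%:R * c').
  transitivity (b * s - 2%:R * (c * s)); first by ring.
  by rewrite bE cE; ring.
have pr0 : p ^+ 2 * r != 0 by rewrite mulf_neq0 ?expf_neq0.
rewrite /double_shape dd; case: (altP (d' =P 0)) => [d'0|d'0] /=; last first.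
  split=> [|d0|_].
  - rewrite (scaled_eq0 (expf_neq0 2 s0) _ AE) ?mulf_neq0 ?expf_neq0 //.
    by rewrite (scaled_eq0 s0 pr0 BE).
  - by rewrite -dd d0 eqxx in d'0.
  have h : p ^+ 4 * r ^+ 2 * s ^+ 2 != 0 by rewrite !mulf_neq0 ?expf_neq0.
  apply: (mulfI h); transitivity
    ((a * d - b * c) * s ^+ 2 * (p ^+ 2 * r * (b' - 2%:R * c')) ^+ 2).
    by ring.
  by rewrite AE -BE; ring.
rewrite d'0 in aE bE cE eE dd.
have bE' : b * s = p ^+ 2 * r * b' by rewrite bE; ring.
have cE' : c * s = p ^+ 2 * r * c' by rewrite cE; ring.
have bcE : (b + 2%:R * c) * s = p ^+ 2 * r * (b' + 2%:R * c').
  transitivity (b * s + 2%:R * (c * s)); first by ring.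
  by rewrite bE' cE'; ring.
split=> [|_|]; last by rewrite ?dd ?eqxx.
  rewrite (scaled_eq0 s0 pr0 bE') (scaled_eq0 s0 pr0 cE').
  rewrite (scaled_eq0 s0 pr0 bcE).
  have ee : b' = 0 -> (e == 0) = (e' == 0).
    move=> b'0; have r2 : r ^+ 2 != 0 by rewrite expf_neq0.
    by apply: (scaled_eq0 s0 r2); rewrite eE b'0; ring.
  have aa : b' + 2%:R * c' = 0 -> (a == 0) = (a' == 0).
    move=> bc'; have p3 : p ^+ 3 != 0 by rewrite expf_neq0.
    apply: (scaled_eq0 s0 p3); rewrite aE.
    rewrite (_ : b' = - (2%:R * c')); first by ring.
    by apply/eqP; rewrite -addr_eq0 bc'.
  have [b'0|_] /= := eqVneq b' 0; first by rewrite (ee b'0).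
  by have [/aa ->|_] /= := eqVneq (b' + 2%:R * c') 0.
apply: (mulfI (mulf_neq0 s0 pr0)).
transitivity (b * s * (p ^+ 2 * r * c')); first by ring.
by rewrite -cE' bE'; ring.
Qed.

(** Isomorphisms rescale the coefficients by nonzero factors, possibly after exchanging f with e and
    b with c; this is a function of the vanishing pattern that is symmetric under the exchange. *)
Definition split_shape f b c e : nat :=
  if (b != 0) && (c != 0) then 13%N
  else if (b != 0) || (c != 0) then
    if (f != 0) && (b != 0) || (e != 0) && (c != 0) then 12%N
    else if (f == 0) && (e == 0) then 14%N else 15%N
  else if (f != 0) && (e != 0) then 10%N else 11%N.

Lemma split_iso_shape f b c e f' b' c' e' :
    [|| f != 0, b != 0, c != 0 | e != 0] ->
    isomorphic (split_form f b c e) (split_form f' b' c' e') ->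
  split_shape f b c e = split_shape f' b' c' e'.
Proof.
move=> nz /split_iso/(_ nz) [p [r [s [[p0 r0 s0] H]]]].
have nz1 : p ^+ 3 != 0 by rewrite expf_neq0.
have nz2 : p * r ^+ 2 != 0 by rewrite mulf_neq0 ?expf_neq0.
have nz3 : p ^+ 2 * r != 0 by rewrite mulf_neq0 ?expf_neq0.
have nz4 : r ^+ 3 != 0 by rewrite expf_neq0.
case: H => -[/(scaled_eq0 s0 nz1) fE /(scaled_eq0 s0 nz2) bE
             /(scaled_eq0 s0 nz3) cE /(scaled_eq0 s0 nz4) eE];
  rewrite /split_shape fE bE cE eE //.
by case: (f' == 0); case: (b' == 0); case: (c' == 0); case: (e' == 0).
Qed.

(** The two coefficients equal to 1 force p = r and s = p^3, so no rescaling survives and only the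
    exchange remains. *)
Lemma J27_iso (e f e' f' : K) :
    isomorphic (split_form f 1 1 e) (split_form f' 1 1 e') ->
  (e = e' /\ f = f') \/ (e = f' /\ f = e').
Proof.
case/split_iso => [|p [r [s [[p0 r0 s0] H]]]]; first by rewrite oner_eq0 orbT.
have main x y x' y' : [/\ x * s = p ^+ 3 * x', 1 * s = p * r ^+ 2 * 1,
    1 * s = p ^+ 2 * r * 1 & y * s = r ^+ 3 * y'] -> y = y' /\ x = x'.
  case=> xE; rewrite !mul1r !mulr1 => sE sE' yE.
  have pr : p = r.
    apply: (mulfI (mulf_neq0 p0 r0)); transitivity s; last by rewrite sE; ring.
    by rewrite sE'; ring.
  have sp : s = p ^+ 3 by rewrite sE -pr; ring.
  rewrite -pr -sp in xE yE.
  by split; apply: (mulIf s0); rewrite ?xE ?yE mulrC.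
by case: H => /main; [left | right].
Qed.

(** The zero coefficient rules out the exchange, and the two coefficients equal to 1 give p^2 = r^2;
    the solution p = - r is what identifies opposite parameters. *)
Lemma J26_iso (e e' : K) :
    isomorphic (split_form 1 1 0 e) (split_form 1 1 0 e') ->
  e = e' \/ e = - e'.
Proof.
case/split_iso => [|p [r [s [[p0 r0 s0] H]]]]; first by rewrite oner_eq0.
case: H => -[fE bE cE eE]; last first.
  have /eqP := bE; rewrite mulr0 mul1r => s00.
  by rewrite s00 in s0.
rewrite mul1r mulr1 in fE; rewrite mul1r mulr1 in bE.
have : p ^+ 2 = r ^+ 2.
  apply: (mulfI p0); transitivity s; last exact: bE.
  by rewrite fE; ring.
move/eqP; rewrite eqf_sqr => /orP[]/eqP pr; rewrite pr in fE; [left|right].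
  apply: (mulIf s0); rewrite eE fE; ring.
apply: (mulIf s0); rewrite eE fE; ring.
Qed.

Lemma J15_mul a (x y : 'rV[K]_5) : table_mul (alg (J15 a)) x y =
  vec5 0 (co x 1 * co y 1) (co x 1 * co y 2 + co x 2 * co y 1) 0
    (a * (co x 4 * co y 4) + co x 2 * co y 2
     + (co x 1 * co y 3 + co x 3 * co y 1)
     + (co x 2 * co y 4 + co x 4 * co y 2)).
Proof. by vec_eval; split; ring. Qed.

(** Let u and v be the images of n_1 and n_4. From n_1 n_4 = 0 follows v_1 = v_2 = 0. As n_5 = n_1
    (n_1 n_1^2) is scaled by u_1^4, n_2 n_4 = n_5 gives v_4 = u_1^2, so n_4^2 is scaled by the same
    factor u_1^4 as n_5. *)
Lemma J15_iso a a' : isomorphic (alg (J15 a)) (alg (J15 a')) -> a = a'.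
Proof.
have J15_basis (k : K) :
    [/\ table_mul (alg (J15 k)) (n 1) (n 1) = n 2,
        table_mul (alg (J15 k)) (n 1) (n 2) = n 3,
        table_mul (alg (J15 k)) (n 1) (n 3) = n 5,
        table_mul (alg (J15 k)) (n 1) (n 4) = 0
      & table_mul (alg (J15 k)) (n 2) (n 4) = n 5
        /\ table_mul (alg (J15 k)) (n 4) (n 4) = k *: n 5].
  split; try split; rewrite J15_mul; apply: vecP5;
    rewrite !co_vec5 ?coE !co_n //=; split; ring.
case=> f [bij_f fM]; have [b11 b12 b13 b14 [b24 b44]] := J15_basis a.
have f2 := fM (n 1) (n 1); have f3 := fM (n 1) (n 2).
have f5 := fM (n 1) (n 3); have f0 := fM (n 1) (n 4).
have f5' := fM (n 2) (n 4); have f5'' := fM (n 4) (n 4).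
rewrite b11 in f2; rewrite b12 f2 in f3; rewrite b13 f3 in f5.
rewrite b14 linear0 in f0; rewrite b24 f2 in f5'.
rewrite b44 linearZ /= in f5''.
move: f5 f0 f5' f5'' => {f2 f3}; set u := f (n 1); set v := f (n 4).
rewrite !J15_mul => f5 f0 f5' f5''.
have f55 : co (f (n 5)) 5 = co u 1 ^+ 4 by rewrite f5 !co_vec5; ring.
have u1 : co u 1 != 0.
  have := linear_bij_neq0 bij_f (n_neq0 K (isT : 0 < 5 <= 5)%N).
  apply: contra_neq => u1; rewrite f5.
  by apply: vecP5; rewrite !co_vec5 !co0 u1; split; ring.
have v1 : co v 1 = 0.
  have /eqP := congr1 (fun z : 'rV[K]_5 => co z 2) f0.
  by rewrite co0 co_vec5 eq_sym mulf_eq0 (negPf u1) => /eqP.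
have v2 : co v 2 = 0.
  have /eqP := congr1 (fun z : 'rV[K]_5 => co z 3) f0.
  by rewrite co0 co_vec5 v1 mulr0 addr0 eq_sym mulf_eq0 (negPf u1) => /eqP.
have v4 : co v 4 = co u 1 ^+ 2.
  have /esym := congr1 (fun z : 'rV[K]_5 => co z 5) f5'.
  rewrite f55 !co_vec5 v1 v2 => eq_v4.
  have u2 : co u 1 ^+ 2 != 0 by rewrite expf_neq0.
  apply: (mulfI u2); transitivity (co u 1 ^+ 4); last by ring.
  by rewrite -eq_v4; ring.
have := congr1 (fun z : 'rV[K]_5 => co z 5) f5''.
rewrite coZ f55 !co_vec5 v1 v2 v4 => eq_a.
have u4 : co u 1 ^+ 4 != 0 by rewrite expf_neq0.
by apply: (mulIf u4); rewrite eq_a; ring.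
Qed.

End Shapes.

(** * Signatures *)

Definition square_eq := App (Mul (Var 0) (Var 1)).
Definition cube_eq := App (Mul (Var 0) (Mul (Var 1) (Var 2))).
Definition derivation_eq :=
  Sub (Sub (App (Mul (Var 0) (Var 1))) (Mul (App (Var 0)) (Var 1)))
    (Mul (Var 0) (App (Var 1))).
Definition quasicentroid_eq :=
  Sub (Mul (App (Var 0)) (Var 1)) (Mul (Var 0) (App (Var 1))).
Definition triple_derivation_eq :=
  Sub (Sub (Sub (App (Mul (Var 0) (Mul (Var 1) (Var 2))))
    (Mul (App (Var 0)) (Mul (Var 1) (Var 2))))
    (Mul (Var 0) (Mul (App (Var 1)) (Var 2))))
    (Mul (Var 0) (Mul (Var 1) (App (Var 2)))).

(* The first two conditions say that D vanishes on A^2 and on A^3, so that the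
   dimensions are 5 (5 - dim A^2) and 5 (5 - dim A^3). *)
Definition invariants : seq expr :=
  [:: square_eq; cube_eq; derivation_eq; quasicentroid_eq;
      triple_derivation_eq].

Definition rigid_tables : seq ztable :=
  (let e k := [:: (k, 1%Zc)] in
  [::
    [:: (1, 1, e 2); (1, 2, e 3); (2, 2, e 4); (1, 3, e 4); (1, 4, e 5);
      (2, 3, e 5)];
    [:: (1, 1, e 2); (1, 2, e 3); (2, 2, e 4); (1, 3, e 4); (5, 5, e 4)];
    [:: (1, 1, e 2); (1, 2, e 3); (2, 2, e 4); (1, 3, e 4)];
    [:: (1, 3, e 4); (2, 3, e 5); (1, 2, [:: (4%N, 1%Zc); (5%N, -1%Zc)])];
    [:: (1, 3, e 5); (1, 2, e 4); (2, 3, [:: (5%N, -1%Zc)])];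
    [:: (1, 1, e 4); (2, 3, e 4); (1, 3, e 5)];
    [:: (1, 2, e 4); (1, 3, e 5)];
    [:: (3, 3, e 4); (1, 2, e 5); (3, 4, e 5)];
    [:: (1, 1, e 2); (4, 4, e 3); (1, 2, e 3)];
    [:: (1, 1, e 3); (2, 2, e 3); (4, 4, e 5)];
    [:: (1, 1, e 3); (2, 2, e 5); (1, 2, e 4)];
    [:: (1, 1, e 4); (3, 3, e 5); (1, 2, e 5)];
    [:: (1, 1, e 2); (1, 2, e 3)];
    [:: (1, 1, e 2); (3, 3, e 4)];
    [:: (1, 1, e 2); (1, 3, e 4)];
    [:: (2, 3, e 5); (1, 4, e 5)];
    [:: (1, 1, e 2); (3, 4, e 2)];
    [:: (1, 1, e 3); (2, 2, e 3)];
    [:: (1, 1, e 2)];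
    [::];
    [:: (1, 1, e 2); (1, 2, e 3); (2, 4, e 3)];
    [:: (1, 1, e 2); (4, 4, [:: (2%N, -1%Zc)]); (1, 2, e 3); (2, 4, e 3)];
    [:: (1, 1, e 2); (4, 4, [:: (2%N, -1%Zc); (3%N, -1%Zc)]); (1, 2, e 3);
      (2, 4, e 3)];
    [:: (1, 1, e 2); (4, 4, e 2); (1, 2, e 3)];
    [:: (1, 1, e 2); (4, 4, e 5); (2, 3, e 5)];
    [:: (1, 1, e 2); (1, 4, e 5); (2, 3, e 5)];
    [:: (1, 2, e 3); (3, 4, e 5)];
    [:: (1, 2, e 3); (3, 4, e 5); (1, 1, e 5)];
    [:: (1, 2, e 3); (3, 4, e 5); (1, 1, e 5); (2, 2, e 5)];
    [:: (1, 2, e 3); (1, 3, e 5); (4, 4, e 5); (2, 3, e 5)];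
    [:: (1, 2, e 3); (1, 3, e 5); (4, 4, e 5)];
    [:: (1, 2, e 3); (1, 3, e 5); (4, 4, e 5); (2, 2, e 5)];
    [:: (1, 2, e 3); (1, 4, e 5); (1, 3, e 5); (2, 3, e 5)];
    [:: (1, 2, e 3); (1, 3, e 5); (2, 4, e 5)];
    [:: (1, 2, e 4); (3, 3, e 4); (1, 4, e 5)];
    [:: (1, 2, e 4); (3, 3, e 4); (1, 4, e 5); (2, 3, e 5)];
    [:: (1, 2, e 4); (3, 3, e 4); (1, 4, e 5); (2, 2, e 5)];
    [:: (1, 2, e 4); (3, 3, e 4); (3, 4, e 5)];
    [:: (1, 2, e 4); (3, 3, e 4); (3, 4, e 5); (1, 1, e 5)];
    [:: (1, 2, e 4); (3, 3, e 4); (3, 4, e 5); (1, 1, e 5); (2, 2, e 5)];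
    [:: (1, 1, e 2); (1, 2, e 4); (3, 3, e 4); (2, 2, e 5); (1, 4, e 5)];
    [:: (1, 1, e 2); (2, 3, e 4); (1, 2, e 5)];
    [:: (1, 1, e 2); (2, 3, e 4); (1, 2, e 5); (1, 3, e 5)];
    [:: (1, 1, e 2); (2, 3, e 4); (1, 2, e 5); (3, 3, e 5)];
    [:: (1, 2, e 3); (1, 3, e 4); (2, 3, e 5)];
    [:: (1, 2, e 3); (1, 3, e 4); (1, 1, e 5); (2, 3, e 5)];
    [:: (1, 2, e 3); (2, 2, e 4); (1, 3, e 4); (1, 1, e 5); (2, 3, e 5)]])%N.

(* Only two of the dimensions are needed for the family J15 and for the algebras
   with dim A^2 = 3 and dim A^3 = 1, the last two entries. *)
Definition signatures : seq (seq (option nat)) :=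
  ([seq [seq Some d | d <- dims] | dims <- [::
      [:: 5; 10; 5; 9; 8]; [:: 10; 15; 6; 10; 12]; [:: 10; 15; 7; 13; 12];
      [:: 15; 25; 7; 13; 25]; [:: 15; 25; 8; 13; 25]; [:: 15; 25; 9; 13; 25];
      [:: 15; 25; 11; 13; 25]; [:: 15; 20; 8; 12; 17]; [:: 15; 20; 9; 14; 17];
      [:: 15; 25; 9; 14; 25]; [:: 10; 25; 10; 16; 25]; [:: 15; 25; 10; 14; 25];
      [:: 15; 20; 11; 17; 17]; [:: 15; 25; 11; 17; 25]; [:: 15; 25; 12; 17; 25];
      [:: 20; 25; 11; 15; 25]; [:: 20; 25; 12; 16; 25]; [:: 20; 25; 14; 18; 25];
      [:: 20; 25; 17; 21; 25]; [:: 25; 25; 25; 25; 25]; [:: 15; 20; 8; 14; 14];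
      [:: 15; 20; 9; 13; 14]; [:: 15; 20; 8; 13; 14]; [:: 15; 20; 7; 13; 13];
      [:: 15; 20; 6; 12; 14]; [:: 15; 20; 7; 12; 14]; [:: 15; 20; 6; 11; 11];
      [:: 15; 20; 5; 10; 11]; [:: 15; 20; 4; 10; 11]; [:: 15; 20; 5; 10; 13];
      [:: 15; 20; 7; 10; 14]; [:: 15; 20; 6; 10; 14]; [:: 15; 20; 6; 11; 13];
      [:: 15; 20; 7; 11; 14]; [:: 15; 20; 6; 10; 11]; [:: 15; 20; 5; 9; 11];
      [:: 15; 20; 4; 9; 11]; [:: 15; 20; 5; 10; 10]; [:: 15; 20; 4; 9; 10];
      [:: 15; 20; 3; 9; 10]; [:: 10; 15; 4; 9; 9]; [:: 10; 15; 7; 12; 12];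
      [:: 10; 15; 6; 12; 12]; [:: 10; 15; 5; 11; 12]; [:: 10; 15; 6; 11; 11];
      [:: 10; 15; 5; 11; 11]; [:: 10; 15; 4; 11; 11]]]
   ++ [:: [:: None; Some 15; None; None; Some 10];
          [:: Some 10; Some 20; None; None; None]])%N.

Section Signatures.
Variable K : fieldType.

Definition rigid_labels : seq (label K) :=
  [:: eps1 _; eps2 _; eps5 _; eps7 _; eps9 _; eps11 _; eps12 _; eps13 _;
    eps14 _; eps15 _; eps16 _; eps17 _; eps18 _; eps19 _; eps20 _; eps21 _;
    eps22 _;
    eps23 _; eps24 _; eps25 _; J1 _; J2 _; J3 _; J4 _; J5 _; J6 _; J7 _; J8 _;
    J9 _; J10 _; J11 _; J12 _; J13 _; J14 _; J16 _; J17 _; J18 _; J19 _; J20 _;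
    J21 _; J22 _; J31 _; J32 _; J33 _; J36 _; J38 _; J40 _].

(** The row of [signatures] that belongs to the label: its position in [rigid_labels], then 47 for
    J15, and 48 for all algebras with dim A^2 = 3 and dim A^3 = 1, which signatures do not tell
    apart. *)
Definition kind (a : label K) : nat :=
  match a with
  | eps1 => 0 | eps2 => 1 | eps5 => 2 | eps7 => 3 | eps9 => 4 | eps11 => 5
  | eps12 => 6 | eps13 => 7 | eps14 => 8 | eps15 => 9 | eps16 => 10
  | eps17 => 11 | eps18 => 12 | eps19 => 13 | eps20 => 14 | eps21 => 15
  | eps22 => 16 | eps23 => 17 | eps24 => 18 | eps25 => 19 | J1 => 20 | J2 => 21
  | J3 => 22 | J4 => 23 | J5 => 24 | J6 => 25 | J7 => 26 | J8 => 27 | J9 => 28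
  | J10 => 29 | J11 => 30 | J12 => 31 | J13 => 32 | J14 => 33 | J15 _ => 47
  | J16 => 34 | J17 => 35 | J18 => 36 | J19 => 37 | J20 => 38 | J21 => 39
  | J22 => 40 | J31 => 41 | J32 => 42 | J33 => 43 | J36 => 44 | J38 => 45
  | J40 => 46
  | _ => 48
  end.

End Signatures.

(** [None] stands for a dimension that is not provided and so never separates. *)
Definition compatible (s s' : seq (option nat)) : bool :=
  all2 (fun x y => if x is Some d then if y is Some d' then d == d' else true
                   else true) s s'.

(** As all these entries of [signatures] are [Some], the computation also certifies that admissible
    pivots were found in every one of the systems. *)
Lemma rigid_dims :
  [seq [seq holds_dim T e | e <- invariants] | T <- rigid_tables] =
  take 47 signatures.
Proof. by vm_compute. Qed.

Lemma rigid_valid : all valid rigid_tables.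
Proof. by []. Qed.

Lemma invariants_multilinear : all multilinear invariants.
Proof. by []. Qed.

Lemma signatures_separate :
  all (fun i => all (fun j => (i == j) ||
      ~~ compatible (nth [::] signatures i) (nth [::] signatures j))
    (iota 0 49)) (iota 0 49).
Proof. by vm_compute. Qed.

Section IntegralAlgebras.
Variable K : fieldType.

Lemma vec_cons k z u : vec K ((k, z) :: u) = ZK K z *: n k + vec K u.
Proof. exact: big_cons. Qed.

Lemma vec_nil : vec K [::] = 0.
Proof. exact: big_nil. Qed.

Lemma ZK1 : ZK K 1%Zc = 1.
Proof. by []. Qed.

Lemma rigid_labelsE :
  [seq alg a | a <- rigid_labels K] = [seq of_ztable K T | T <- rigid_tables].
Proof.
have ZKm1 : ZK K (-1)%Zc = -1 by [].
rewrite /= /of_ztable /= !vec_cons !vec_nil !ZK1 !ZKm1.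
by rewrite !scaleN1r !scale1r !addr0.
Qed.

End IntegralAlgebras.

Section HasSignature.
Variable K : fieldType.
Hypothesis K2 : (2%:R : K) != 0.
Hypothesis K3 : (3%:R : K) != 0.
Implicit Types (t u : table K) (s : seq (option nat)).

Definition has_signature t s := forall i d, nth None s i = Some d ->
  has_dim (holds t (nth (Var 0) invariants i)) d.

Lemma has_signature_iso t u s :
  isomorphic t u -> has_signature t s -> has_signature u s.
Proof. by move=> tu ts i d /ts; apply: holds_isomorphic. Qed.

Lemma has_signature_compatible t s s' : size s = size s' ->
  has_signature t s -> has_signature t s' -> compatible s s'.
Proof.
move=> eq_size ts ts'; rewrite /compatible all2E eq_size eqxx /=.
apply/(all_nthP (None, None)) => i _; rewrite nth_zip //=.
case si: (nth _ s i) => [d|] //; case si': (nth _ s' i) => [d'|] //.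
by apply/eqP; apply: has_dim_uniq (ts _ _ si) (ts' _ _ si').
Qed.

Lemma rigid_signature a : (kind a < 47)%N ->
  has_signature (alg a) (nth [::] signatures (kind a)).
Proof.
move=> a47.
have algE : alg a = of_ztable K (nth [::] rigid_tables (kind a)).
  transitivity (nth [::] [seq alg b | b <- rigid_labels K] (kind a)).
    by case: a a47.
  by rewrite rigid_labelsE (nth_map [::]).
have sigE : nth [::] signatures (kind a) =
    [seq holds_dim (nth [::] rigid_tables (kind a)) e | e <- invariants].
  by rewrite -(nth_take [::] a47) -rigid_dims (nth_map [::]).
move=> i d; rewrite sigE algE => dE.
have i5 : (i < size invariants)%N.
  by case: ltnP dE => // i5; rewrite nth_default // size_map.
rewrite (nth_map (Var 0)) // in dE.
apply: holds_dimP dE => //.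
  by apply: (all_nthP [::] rigid_valid).
exact: (all_nthP (Var 0) invariants_multilinear).
Qed.

(* Applies to J15: its parameter only occurs in n_4^2, which is annihilated. *)
Lemma eq_triple_signature t u :
    (forall x y z, table_mul t x (table_mul t y z)
                 = table_mul u x (table_mul u y z)) ->
  forall D, (holds t cube_eq D <-> holds u cube_eq D) /\
    (holds t triple_derivation_eq D <-> holds u triple_derivation_eq D).
Proof.
move=> tu D; split; split=> h x; have := h x; rewrite /= ?tu //.
Qed.

(** The member of the family with parameter 0. *)
Definition J15_table : ztable :=
  [:: ((1, 1), [:: (2, 1%Zc)]); ((1, 2), [:: (3, 1%Zc)]);
      ((2, 2), [:: (5, 1%Zc)]); ((1, 3), [:: (5, 1%Zc)]);
      ((2, 4), [:: (5, 1%Zc)])]%N.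

Lemma J15_signature (a : K) :
  has_signature (alg (J15 a)) [:: None; Some 15%N; None; None; Some 10%N].
Proof.
have tuE x y z : table_mul (of_ztable K J15_table) x
      (table_mul (of_ztable K J15_table) y z)
    = table_mul (alg (J15 a)) x (table_mul (alg (J15 a)) y z).
  have mE x' y' : table_mul (of_ztable K J15_table) x' y' =
      vec5 0 (co x' 1 * co y' 1) (co x' 1 * co y' 2 + co x' 2 * co y' 1) 0
        (co x' 2 * co y' 2 + (co x' 1 * co y' 3 + co x' 3 * co y' 1)
          + (co x' 2 * co y' 4 + co x' 4 * co y' 2)).
    rewrite /of_ztable /= !vec_cons !vec_nil !ZK1 !scale1r !addr0.
    by vec_eval; split; ring.
  rewrite !mE !J15_mul; apply: vecP5; rewrite !co_vec5; split; ring.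
have [cubeE tripleE] : (forall D, holds (of_ztable K J15_table) cube_eq D <->
      holds (alg (J15 a)) cube_eq D) /\
    (forall D, holds (of_ztable K J15_table) triple_derivation_eq D <->
      holds (alg (J15 a)) triple_derivation_eq D).
  by split=> D; case: (eq_triple_signature tuE D).
case=> [|[|[|[|[|i]]]]] d //=; [| |by rewrite nth_nil]; case=> <-.
  by apply: eq_has_dim cubeE _; apply: holds_dimP.
by rewrite /=; apply: eq_has_dim tripleE _; apply: holds_dimP.
Qed.

Definition kernel_condition (D : 'M[K]_5) :=
  [/\ n 3 *m D = 0, n 4 *m D = 0 & n 5 *m D = 0].

Lemma vec5_mulmx a b c d e (D : 'M[K]_5) : vec5 a b c d e *m D =
  a *: (n 1 *m D) + b *: (n 2 *m D) + c *: (n 3 *m D) + d *: (n 4 *m D)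
  + e *: (n 5 *m D).
Proof. by rewrite /vec5 -lock !mulmxDl -!scalemxAl. Qed.

Definition basis_env (i j k : nat) : nat -> 'rV[K]_5 :=
  fun l => n (nth 0%N [:: i; j; k] l).

Lemma scale_mulmx_eq0 c (v : 'rV[K]_5) (D : 'M[K]_5) :
  c != 0 -> (c *: v) *m D = 0 -> v *m D = 0.
Proof.
by move=> /negPf c0 /eqP; rewrite -scalemxAl scaler_eq0 c0 => /eqP.
Qed.

(** Whatever the parameters, A^2 is spanned by n_3, n_4, n_5 and A^3 by n_5, some coefficient being
    nonzero. This makes the conditions independent of the table, so that one integral table can
    serve for all. *)
Lemma double_conditions a b c d e D : [|| a != 0, b != 0, c != 0 | d != 0] ->
  (holds (double_form a b c d e) square_eq D <-> kernel_condition D) /\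
  (holds (double_form a b c d e) cube_eq D <-> n 5 *m D = 0).
Proof.
move=> nz; set t := double_form a b c d e.
have [m11 m12] : table_mul t (n 1) (n 1) = n 3 /\ table_mul t (n 1) (n 2) = n 4.
  by split; rewrite /t; vec_eval; split; ring.
have [m13 m23] : table_mul t (n 1) (n 3) = a *: n 5 /\
    table_mul t (n 2) (n 3) = b *: n 5.
  by split; rewrite /t; vec_eval; split; ring.
have [m14 m24] : table_mul t (n 1) (n 4) = c *: n 5 /\
    table_mul t (n 2) (n 4) = d *: n 5.
  by split; rewrite /t; vec_eval; split; ring.
split; split.
- move=> h; have h' i j : table_mul t (n i) (n j) *m D = 0.
    exact: h (basis_env i j 0).
  split; first by rewrite -m11 h'.
    by rewrite -m12 h'.
  by case/or4P: nz => z; apply: (scale_mulmx_eq0 z);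
    rewrite -?m13 -?m23 -?m14 -?m24 h'.
- case=> D3 D4 D5 x; rewrite /= /t double_mul vec5_mulmx D3 D4 D5.
  by rewrite !scale0r !scaler0 !addr0.
- move=> h.
  have h' i j k : table_mul t (n i) (table_mul t (n j) (n k)) *m D = 0.
    exact: h (basis_env i j k).
  case/or4P: nz => z; apply: (scale_mulmx_eq0 z);
    [rewrite -m13 -m11 | rewrite -m23 -m11 | rewrite -m14 -m12
    | rewrite -m24 -m12]; exact: h'.
- move=> D5 x; rewrite /= /t !double_mul vec5_mulmx !co_vec5 D5 !mulr0 !addr0.
  by rewrite !scale0r !scaler0 !addr0.
Qed.

Lemma split_conditions f b c e D : [|| f != 0, b != 0, c != 0 | e != 0] ->
  (holds (split_form f b c e) square_eq D <-> kernel_condition D) /\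
  (holds (split_form f b c e) cube_eq D <-> n 5 *m D = 0).
Proof.
move=> nz; set t := split_form f b c e.
have [m11 m22] : table_mul t (n 1) (n 1) = n 3 /\ table_mul t (n 2) (n 2) = n 4.
  by split; rewrite /t; vec_eval; split; ring.
have [m13 m14] : table_mul t (n 1) (n 3) = f *: n 5 /\
    table_mul t (n 1) (n 4) = b *: n 5.
  by split; rewrite /t; vec_eval; split; ring.
have [m23 m24] : table_mul t (n 2) (n 3) = c *: n 5 /\
    table_mul t (n 2) (n 4) = e *: n 5.
  by split; rewrite /t; vec_eval; split; ring.
split; split.
- move=> h; have h' i j : table_mul t (n i) (n j) *m D = 0.
    exact: h (basis_env i j 0).
  split; first by rewrite -m11 h'.
    by rewrite -m22 h'.
  by case/or4P: nz => z; apply: (scale_mulmx_eq0 z);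
    rewrite -?m13 -?m23 -?m14 -?m24 h'.
- case=> D3 D4 D5 x; rewrite /= /t split_mul vec5_mulmx D3 D4 D5.
  by rewrite !scale0r !scaler0 !addr0.
- move=> h.
  have h' i j k : table_mul t (n i) (table_mul t (n j) (n k)) *m D = 0.
    exact: h (basis_env i j k).
  case/or4P: nz => z; apply: (scale_mulmx_eq0 z);
    [rewrite -m13 -m11 | rewrite -m14 -m22 | rewrite -m23 -m11
    | rewrite -m24 -m22]; exact: h'.
- move=> D5 x; rewrite /= /t !split_mul vec5_mulmx !co_vec5 D5 !mulr0 !addr0.
  by rewrite !scale0r !scaler0 !addr0.
Qed.

Definition reference_table : ztable :=
  [:: ((1, 1), [:: (3, 1%Zc)]); ((1, 2), [:: (4, 1%Zc)]);
      ((1, 3), [:: (5, 1%Zc)])]%N.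

Definition form_signature : seq (option nat) :=
  [:: Some 10%N; Some 20%N; None; None; None].

Lemma reference_table_double :
  isomorphic (of_ztable K reference_table) (double_form 1 0 0 0 0).
Proof.
rewrite /of_ztable /= !vec_cons !vec_nil !ZK1 !scale1r !addr0.
iso_by (fun x : 'rV[K]_5 => vec5 (co x 1) (co x 2) (co x 3) (co x 4) (co x 5))
  (fun x : 'rV[K]_5 => vec5 (co x 1) (co x 2) (co x 3) (co x 4) (co x 5));
  split; ring.
Qed.

(** Read off by elimination from [reference_table], which is eps10 up to relabelling. *)
Lemma kernel_condition_dim :
  has_dim kernel_condition 10 /\ has_dim (fun D : 'M[K]_5 => n 5 *m D = 0) 20.
Proof.
have nz : [|| (1 : K) != 0, (0 : K) != 0, (0 : K) != 0 | (0 : K) != 0].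
  by rewrite oner_neq0.
split.
  apply: (eq_has_dim (fun D => (double_conditions 0 D nz).1)).
  by apply: holds_isomorphic reference_table_double _; apply: holds_dimP.
apply: (eq_has_dim (fun D => (double_conditions 0 D nz).2)).
by apply: holds_isomorphic reference_table_double _; apply: holds_dimP.
Qed.

Lemma double_signature a b c d e : [|| a != 0, b != 0, c != 0 | d != 0] ->
  has_signature (double_form a b c d e) form_signature.
Proof.
move=> nz [|[|[|[|[|i]]]]] s //=; last by rewrite nth_nil.
  by case=> <-; apply: eq_has_dim kernel_condition_dim.1 => D;
    split=> /(double_conditions e D nz).1.
by case=> <-; apply: eq_has_dim kernel_condition_dim.2 => D;
  split=> /(double_conditions e D nz).2.
Qed.

Lemma split_signature f b c e : [|| f != 0, b != 0, c != 0 | e != 0] ->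
  has_signature (split_form f b c e) form_signature.
Proof.
move=> nz [|[|[|[|[|i]]]]] s //=; last by rewrite nth_nil.
  by case=> <-; apply: eq_has_dim kernel_condition_dim.1 => D;
    split=> /(split_conditions D nz).1.
by case=> <-; apply: eq_has_dim kernel_condition_dim.2 => D;
  split=> /(split_conditions D nz).2.
Qed.

End HasSignature.

(** * The forms of the labels *)

Inductive form (K : fieldType) :=
  | Double of K & K & K & K & K
  | Split of K & K & K & K.

Section Classification.
Variable K : closedFieldType.
Hypothesis K2 : (2%:R : K) != 0.
Hypothesis K3 : (3%:R : K) != 0.
Implicit Types (a b : label K) (w : form K).

Definition form_table w : table K :=
  match w with
  | Double a b c d e => double_form a b c d e
  | Split f b c e => split_form f b c e
  end.

Definition cube_nonzero w : bool :=
  match w with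
  | Double a b c d _ => [|| a != 0, b != 0, c != 0 | d != 0]
  | Split f b c e => [|| f != 0, b != 0, c != 0 | e != 0]
  end.

Definition shape w : nat :=
  match w with
  | Double a b c d e => double_shape a b c d e
  | Split f b c e => split_shape f b c e
  end.

(** A relation and not a function, because for J41 the form depends on the choice of a square root
    of the parameter. *)
Definition form_of a w : Prop :=
  match a with
  | eps3 => w = Split 1 0 0 1
  | eps4 => w = Double 0 1 1 0 0
  | eps6 => w = Split 1 0 0 0
  | eps8 => w = Double 1 0 0 0 1
  | eps10 => w = Double 1 0 0 0 0
  | J23 b => w = Double 1 b 0 1 0
  | J24 c => w = Double 0 1 c 0 0
  | J25 => w = Double 1 (- 2%:R) 1 0 0
  | J26 d => w = Split 1 1 0 d
  | J27 e f => w = Split f 1 1 e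
  | J28 => w = Split 0 0 1 0
  | J29 => w = Double 0 1 0 0 0
  | J30 => w = Split 0 1 0 1
  | J34 => w = Double 0 0 1 0 0
  | J35 => w = Double 0 0 0 1 0
  | J37 => w = Split (-1) 1 1 (-1)
  | J39 => w = Double 0 0 1 0 1
  | J41 l =>
      [\/ l = 0 /\ w = Double 0 0 1 1 0, l = 1 /\ w = Split 1 1 0 0
        | [/\ l != 0, l != 1 & exists2 s, s ^+ 2 = l
            & w = Split (param27 s)^-1 1 1 (param27 s)]]
  | _ => False
  end.

Definition label_shape a : nat :=
  match a with
  | J23 _ => 1%N | J35 => 2%N
  | J41 l => if l == 0 then 3%N else if l == 1 then 12%N else 13%N
  | J24 _ | eps4 | J29 => 4%N | J25 => 5%N | J34 => 6%N | J39 => 7%N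
  | eps10 => 8%N | eps8 => 9%N | eps3 => 10%N | eps6 => 11%N | J26 _ => 12%N
  | J27 _ _ | J37 => 13%N | J28 => 14%N | J30 => 15%N
  | _ => 0%N
  end.

Lemma square_root (x : K) : exists s, s ^+ 2 = x.
Proof.
have [s sE] := @solve_monicpoly K 2 (fun i => if i is 0%N then x else 0) isT.
by exists s; rewrite sE !big_ord_recl big_ord0 /= expr0 mulr1 mul0r !addr0.
Qed.

Lemma form_ofP a w : form_of a w ->
  isomorphic (alg a) (form_table w) /\ cube_nonzero w.
Proof.
have n1 := oner_neq0 K; case: a => //=; try (move=> ->; split;
  [|by rewrite /= ?n1 ?orbT]).
- exact: eps3_split.
- exact: eps4_double.
- exact: eps6_split.
- exact: eps8_double.
- exact: eps10_double.
- by move=> b ->; split; [exact: J23_double | rewrite /= n1].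
- by move=> c ->; split; [exact: J24_double | rewrite /= n1 orbT].
- exact: J25_double.
- by move=> d ->; split; [exact: J26_split | rewrite /= n1].
- by move=> e f ->; split; [exact: J27_split | rewrite /= n1 orbT].
- exact: J28_split.
- exact: J29_double.
- exact: J30_split.
- exact: J34_double.
- exact: J35_double.
- exact: J37_split.
- exact: J39_double.
move=> l [[-> ->]|[-> ->]|[l0 l1 [s sl ->]]].
- by split; [exact: J41_0_double | rewrite /= n1 !orbT].
- have [i i2] := square_root (-1).
  by split; [exact: J41_1_split i2 | rewrite /= n1].
split; last by rewrite /= n1 orbT.
rewrite -sl; apply: J41_split => //; last by rewrite sl.
by move: l0; rewrite -sl expf_eq0.
Qed.

Lemma form_of_exists a : kind a = 48%N -> exists w, form_of a w.
Proof.
case: a => //=; try by move=> *; eexists.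
move=> lambda _.
have [l0|l0] := eqVneq lambda 0; first by eexists; apply: Or31.
have [l1|l1] := eqVneq lambda 1; first by eexists; apply: Or32.
have [s sl] := square_root lambda.
by eexists; apply: Or33; split=> //; exists s.
Qed.

Lemma form_of_shape a w : form_of a w -> shape w = label_shape a.
Proof.
have /negPf n1 := oner_neq0 K.
have n2 : (- 2%:R == 0 :> K) = false by rewrite oppr_eq0 (negPf K2).
have n1' : (- 1 == 0 :> K) = false by rewrite oppr_eq0 n1.
have simp := (eqxx, n1, n2, n1', mulr0, mulr1, mul0r, subr0, addr0, sub0r,
  add0r, oppr_eq0).
case: a => //= [|||||b|c||d|e f||||||||l];
  try by move=> ->; rewrite /= /double_shape /split_shape ?simp /= ?andbF.
  by move=> ->; rewrite /= /double_shape ?simp addNr eqxx.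
case=> [[-> ->]|[-> ->]|[/negPf -> /negPf -> [s _ ->]]];
  by rewrite /= /double_shape /split_shape ?simp.
Qed.

Lemma form_iso_shape w w' : cube_nonzero w -> cube_nonzero w' ->
  isomorphic (form_table w) (form_table w') -> shape w = shape w'.
Proof.
case: w => [a b c d e|f b c e];
  case: w' => [a' b' c' d' e'|f' b' c' e'] /= nz nz'.
- by case/(double_iso_shape nz).
- by move/(double_split_not_iso nz).
- by move/isomorphic_sym/(double_split_not_iso nz').
- exact: split_iso_shape.
Qed.

Lemma double_linear_iso (c c' : K) :
  isomorphic (double_form 0 1 c 0 0) (double_form 0 1 c' 0 0) -> c = c' :> K.
Proof.
have nz : [|| (0 : K) != 0, (1 : K) != 0, c != 0 | (0 : K) != 0].
  by rewrite oner_neq0 orbT.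
by case/(double_iso_shape nz) => _ /(_ erefl); rewrite !mul1r.
Qed.

Lemma double_square_iso (b b' : K) :
    isomorphic (double_form 1 b 0 1 0) (double_form 1 b' 0 1 0) ->
  b = b' \/ b = - b' :> K.
Proof.
have nz : [|| (1 : K) != 0, b != 0, (0 : K) != 0 | (1 : K) != 0].
  by rewrite oner_neq0.
case/(double_iso_shape nz) => _ _ /(_ (oner_neq0 K)).
rewrite !mulr0 !subr0 !mulr1 !mul1r => /esym/eqP.
by rewrite eqf_sqr => /orP[]/eqP; [left|right].
Qed.

Lemma param27N (s : K) : param27 (- s) = (param27 s)^-1.
Proof.
rewrite /param27 invrN invf_div; congr (- (_ / _)); ring.
Qed.

Lemma param27_eqN1 (s : K) : param27 s = -1 -> s = 0.
Proof.
rewrite /param27 => /oppr_inj.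
(* For s = -1 the denominator is 0, and the quotient is 0 by convention. *)
have [s1|s1] := eqVneq (1 + s) 0.
  by rewrite s1 expr0n /= invr0 mulr0 => /eqP; rewrite eq_sym oner_eq0.
move/(congr1 (fun z => z * (1 + s) ^+ 2)); rewrite mul1r mulfVK ?expf_neq0 //.
move=> E; have : 4%:R * s = 0.
  by transitivity ((1 + s) ^+ 2 - (-1 + s) ^+ 2); [ring | rewrite E subrr].
move/eqP; rewrite (natrM _ 2 2) !mulf_eq0 (negPf K2) /= => /eqP //.
Qed.

(** After clearing denominators, the difference of the two squares is 4 (s - t) (s t - 1). *)
Lemma param27_inj (s t : K) : s ^+ 2 != 1 -> t ^+ 2 != 1 -> t != 0 ->
  param27 s = param27 t -> s ^+ 2 = t ^+ 2 \/ s ^+ 2 = (t ^+ 2)^-1.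
Proof.
have nz (x : K) : x ^+ 2 != 1 -> 1 + x != 0.
  apply: contraNneq => /eqP; rewrite addrC addr_eq0 => /eqP ->.
  by rewrite sqrrN expr1n.
move=> /nz s1 /nz t1 t0 /oppr_inj E.
have : (s - t) * (s * t - 1) = 0.
  have /eqP : ((-1 + s) * (1 + t)) ^+ 2 - ((-1 + t) * (1 + s)) ^+ 2 = 0.
    move/eqP: E; rewrite eqr_div ?expf_neq0 // => /eqP E.
    by rewrite !exprMn E subrr.
  rewrite (_ : _ - _ = 4%:R * ((s - t) * (s * t - 1))); last by ring.
  rewrite (natrM _ 2 2) !mulf_eq0 (negPf K2) /= => st0.
  by apply/eqP; rewrite mulf_eq0.
move/eqP; rewrite mulf_eq0 !subr_eq0 => /orP[/eqP -> |/eqP st]; first by left.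
by right; rewrite -exprVn; congr (_ ^+ 2); apply: (mulIf t0); rewrite mulVf.
Qed.

End Classification.

(** * The classification *)

Section Main.
Variable K : closedFieldType.
Hypothesis K2 : (2%:R : K) != 0.
Hypothesis K3 : (3%:R : K) != 0.
Implicit Types (a b : label K) (w : form K).

Lemma isomorphic_kind a b : a \simeq b -> kind a = kind b.
Proof.
move=> ab.
have sig (c : label K) : has_signature (alg c) (nth [::] signatures (kind c)).
  case: (ltnP (kind c) 47) => c47; first exact: rigid_signature.
  have [c48|c48] := eqVneq (kind c) 48%N.
    have [w cw] := form_of_exists c48.
    have [/isomorphic_sym wc nw] := form_ofP K2 cw.
    rewrite c48; apply: has_signature_iso wc _.
    case: w nw {cw} => * /=; first exact: double_signature.
    exact: split_signature.
  by case: c c47 c48 => // alpha _ _; apply: J15_signature.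
have lt49 (c : label K) : (kind c < 49)%N by case: c.
have kind_in (c : label K) : kind c \in iota 0 49 by rewrite mem_iota /= add0n.
have /allP/(_ _ (kind_in a))/allP/(_ _ (kind_in b)) := signatures_separate.
case/orP => [/eqP //|]; case/negP.
apply: (has_signature_compatible (t := alg b)); last exact: sig.
  have /(all_nthP [::]) sz : all (fun s => size s == 5%N) signatures by [].
  by rewrite (eqP (sz _ (lt49 a))) (eqP (sz _ (lt49 b))).
exact: has_signature_iso ab (sig a).
Qed.

Lemma rigid_kind a : (kind a < 47)%N ->
  a = nth (eps25 K) (rigid_labels K) (kind a).
Proof. by case: a. Qed.

(** The labels that are alone in their shape, at the position of that shape. The filler [eps25] has
    no form, so reaching it is a contradiction; this disposes of the shapes 1, 4, 12 and 13, which
    are shared by several labels. *)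
Definition simple_labels : seq (label K) :=
  [:: eps25 _; eps25 _; J35 _; J41 0; eps25 _; J25 _; J34 _; J39 _; eps10 _;
      eps8 _; eps3 _; eps6 _; eps25 _; eps25 _; J28 _; J30 _].

Variant shape_spec a w : nat -> Prop :=
  | Shape1 (x : K) of a = J23 x & w = Double 1 x 0 1 0 : shape_spec a w 1
  | Shape4 c of w = Double 0 1 c 0 0 &
      [\/ a = J24 c, a = eps4 K /\ c = 1 | a = J29 K /\ c = 0] :
      shape_spec a w 4
  | Shape12 d of w = Split 1 1 0 d & a = J26 d \/ a = J41 1 /\ d = 0 :
      shape_spec a w 12
  | Shape13 e f of w = Split f 1 1 e &
      [\/ a = J27 e f, [/\ a = J37 K, e = -1 & f = -1]
        | exists s, [/\ a = J41 (s ^+ 2), s ^+ 2 != 0, s ^+ 2 != 1,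
                        e = param27 s & f = (param27 s)^-1]] :
      shape_spec a w 13
  | Simple k of a = nth (eps25 K) simple_labels k : shape_spec a w k.

Lemma label_shapeP a w : form_of a w -> shape_spec a w (label_shape a).
Proof.
case: a => //=; try by move=> *; apply: Simple.
- by move=> ->; apply: (@Shape4 _ _ 1) => //; apply: Or32.
- by move=> b ->; apply: Shape1.
- by move=> c ->; apply: (@Shape4 _ _ c) => //; apply: Or31.
- by move=> d ->; apply: (@Shape12 _ _ d) => //; left.
- by move=> e f ->; apply: (@Shape13 _ _ e f) => //; apply: Or31.
- by move=> ->; apply: (@Shape4 _ _ 0) => //; apply: Or33.
- by move=> ->; apply: (@Shape13 _ _ (-1) (-1)) => //; apply: Or32.
move=> l [[-> ->]|[-> ->]|[l0 l1 [s sl ->]]].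
- by rewrite eqxx; apply: Simple.
- by rewrite oner_eq0 eqxx; apply: (@Shape12 _ _ 0) => //; right.
rewrite (negPf l0) (negPf l1); apply: Shape13 => //; apply: Or33.
by exists s; rewrite sl.
Qed.

Lemma same_form a b w : form_of a w -> form_of b w -> a \simeq b.
Proof.
move=> /(form_ofP K2)[aw _] /(form_ofP K2)[/isomorphic_sym bw _].
exact: isomorphic_trans aw bw.
Qed.

Lemma isomorphic_forms a b w w' : form_of a w -> form_of b w' ->
  a \simeq b -> isomorphic (form_table w) (form_table w').
Proof.
move=> /(form_ofP K2)[/isomorphic_sym wa _] /(form_ofP K2)[bw _] ab.
exact: isomorphic_trans wa (isomorphic_trans ab bw).
Qed.

Lemma param27_eqVN1 (s : K) : (param27 s)^-1 = -1 -> s = 0.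
Proof.
by rewrite -param27N => /(param27_eqN1 K2)/eqP; rewrite oppr_eq0 => /eqP.
Qed.

(** The roots s and - s have the same square and inverse values of [param27], so both orders of the
    parameters are instances of [exc41_27]. *)
Lemma exceptional_J41_J27 (s : K) : s ^+ 2 != 0 -> s ^+ 2 != 1 ->
  exceptional (J41 (s ^+ 2)) (J27 (param27 s) (param27 s)^-1) /\
  exceptional (J41 (s ^+ 2)) (J27 (param27 s)^-1 (param27 s)).
Proof.
move=> /eqP s0 /eqP s1; split; first exact: exc41_27.
rewrite -[X in J27 _ X]invrK -param27N.
by apply: exc41_27; rewrite ?sqrrN.
Qed.

Lemma exceptional_forms a b w w' : form_of a w -> form_of b w' -> a <> b ->
  a \simeq b -> exceptional a b \/ exceptional b a.
Proof.
move=> aw bw' ab iso_ab; have iso_w := isomorphic_forms aw bw' iso_ab.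
have shE : label_shape a = label_shape b.
  rewrite -(form_of_shape K2 aw) -(form_of_shape K2 bw').
  by apply: form_iso_shape iso_w;
    [case: (form_ofP K2 aw) | case: (form_ofP K2 bw')].
have not25 (c : label K) w0 : form_of c w0 -> c <> eps25 K.
  by move=> + cE; rewrite cE.
case: (label_shapeP aw) shE => [x aE wE|x wE aE|x wE aE|e f wE aE|k aE];
  case: (label_shapeP bw')
    => [y bE wE'|y wE' bE|y wE' bE|e' f' wE' bE|m bE] // km;
  rewrite -?km in bE; rewrite ?km in aE;
  try (by case: (not25 _ _ bw')); try (by case: (not25 _ _ aw));
  rewrite ?wE ?wE' /= in iso_w.
- case: (double_square_iso iso_w) => xy; rewrite xy in aE.
    by rewrite aE bE in ab.
  by right; rewrite aE bE; apply: exc23.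
- have xy := double_linear_iso iso_w; rewrite -{}xy in bE.
  case: aE => [aE|[aE xE]|[aE xE]]; case: bE => [bE|[bE xE']|[bE xE']];
    rewrite aE bE ?xE ?xE' in ab *; try (by case: ab).
  + by left; apply: exc24_1.
  + by right; apply: exc29.
  + by right; apply: exc24_1.
  + by move/eqP: xE; rewrite xE' eq_sym oner_eq0.
  + by left; apply: exc29.
  + by move/eqP: xE; rewrite xE' oner_eq0.
- have xy := J26_iso iso_w.
  have {xy} [xy|xy] := xy; rewrite xy in aE.
    case: aE => [aE|[aE yE]]; case: bE => [bE|[bE yE']];
      rewrite aE bE ?yE ?yE' in ab *; try (by case: ab).
      by right; apply: exc41_1.
    by left; apply: exc41_1.
  case: aE => [aE|[aE yE]]; case: bE => [bE|[bE yE']];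
    rewrite aE bE ?yE' in ab *; try (by case: ab).
  + by right; apply: exc26.
  + by right; rewrite oppr0; apply: exc41_1.
  + left; have -> : y = 0 by rewrite -[y]opprK yE oppr0.
    exact: exc41_1.
- have eqs := J27_iso iso_w.
  case: aE => [aE|[aE eE fE]|[s [aE s0 s1 eE fE]]];
    case: bE => [bE|[bE eE' fE']|[t [bE t0 t1 eE' fE']]]; rewrite aE bE in ab *.
  + case: eqs => -[ee ff]; rewrite ee ff in ab *; first by case: ab.
    by left; apply: exc27.
  + by right; case: eqs => -[-> ->]; rewrite eE' fE'; apply: exc37.
  + have [exc1 exc2] := exceptional_J41_J27 t0 t1.
    by right; case: eqs => -[-> ->]; rewrite eE' fE'.
  + by left; case: eqs => -[<- <-]; rewrite eE fE; apply: exc37.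
  + by case: ab.
  (* J37 has both parameters equal to -1, and [param27] takes the value -1 only at 0, the excluded
     root. *)
  + have param27N1 : param27 t = -1 \/ (param27 t)^-1 = -1.
      by case: eqs => -[ee _];
        [left; rewrite -eE' -ee | right; rewrite -fE' -ee].
    suff t00 : t = 0 by rewrite t00 expr0n eqxx in t0.
    by case: param27N1 => [/(param27_eqN1 K2)|/param27_eqVN1].
  + have [exc1 exc2] := exceptional_J41_J27 s0 s1.
    by left; case: eqs => -[<- <-]; rewrite eE fE.
  + have param27N1 : param27 s = -1 \/ (param27 s)^-1 = -1.
      by case: eqs => -[ee ff]; [left; rewrite -eE ee | right; rewrite -fE ff].
    suff s00 : s = 0 by rewrite s00 expr0n eqxx in s0.
    by case: param27N1 => [/(param27_eqN1 K2)|/param27_eqVN1].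
  have t00 : t != 0 by apply: contraNneq t0 => ->; rewrite expr0n.
  have : s ^+ 2 = t ^+ 2 \/ s ^+ 2 = (t ^+ 2)^-1.
    case: eqs => -[ee _]; rewrite eE ?eE' ?fE' in ee.
      exact: param27_inj ee.
    rewrite -param27N in ee; rewrite -(sqrrN t).
    by apply: param27_inj ee; rewrite ?sqrrN ?oppr_eq0.
  case=> st; first by rewrite st in ab; case: ab.
  by right; rewrite st; apply: exc41.
by case: ab; rewrite aE bE km.
Qed.

Lemma isomorphic_exceptional a b : a <> b -> a \simeq b ->
  exceptional a b \/ exceptional b a.
Proof.
move=> ab iso_ab; have kE := isomorphic_kind iso_ab.
have [a48|a48] := eqVneq (kind a) 48%N.
  have b48 : kind b = 48%N by rewrite -kE.
  have [w aw] := form_of_exists a48; have [w' bw'] := form_of_exists b48.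
  exact: exceptional_forms aw bw' ab iso_ab.
have [a47|a47] := ltnP (kind a) 47.
  by case: ab; rewrite (rigid_kind a47) kE -rigid_kind // -kE.
(* Only kind 47 is left, that is, the family J15. *)
case: a ab iso_ab kE a47 a48 => // alpha ab iso_ab kE _ _.
case: b ab iso_ab kE => // alpha' ab /J15_iso eq_alpha _.
by rewrite eq_alpha in ab.
Qed.

Lemma param27V (s : K) : s != 0 -> param27 s^-1 = param27 s.
Proof.
move=> s0; rewrite /param27; congr (- _); rewrite -!expr_div_n.
have -> : 1 + s^-1 = (1 + s) / s by field.
have -> : -1 + s^-1 = - ((-1 + s) / s) by field.
by rewrite invf_div mulNr mulrA divfK // sqrrN.
Qed.

(** Inverse square roots have the same [param27], so both algebras have the same form; 0 and 1 are
    their own inverses. *)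
Lemma J41V (l : K) : J41 l^-1 \simeq J41 l.
Proof.
have [->|l0] := eqVneq l 0; first by rewrite invr0; apply: isomorphic_refl.
have [->|l1] := eqVneq l 1; first by rewrite invr1; apply: isomorphic_refl.
have [s sl] := square_root l.
have s0 : s != 0 by apply: contraNneq l0 => s0; rewrite -sl s0 expr0n.
apply: (same_form (w := Split (param27 s)^-1 1 1 (param27 s))).
  apply: Or33; rewrite invr_eq0 l0 invr_eq1 l1; split=> //.
  by exists s^-1; rewrite ?param27V // exprVn sl.
by apply: Or33; split=> //; exists s.
Qed.

Lemma J23N (b : K) : J23 (- b) \simeq J23 b.
Proof.
apply: isomorphic_trans (J23_double _) _; apply: isomorphic_sym.
apply: isomorphic_trans (J23_double _) _.
by have := double_neg 1 b 0 1 0; rewrite oppr0.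
Qed.

Lemma J26N (d : K) : J26 (- d) \simeq J26 d.
Proof.
apply: isomorphic_trans (J26_split _) _; apply: isomorphic_sym.
apply: isomorphic_trans (J26_split _) _.
by have := split_neg 1 1 0 d; rewrite oppr0.
Qed.

Lemma J27C (e f : K) : J27 e f \simeq J27 f e.
Proof.
apply: isomorphic_trans (J27_split _ _) _; apply: isomorphic_sym.
apply: isomorphic_trans (J27_split _ _) _; exact: split_swap.
Qed.

Lemma J24_1_associative : associative (table_mul (alg (J24 (1 : K)))).
Proof.
have mE x y : table_mul (alg (J24 (1 : K))) x y =
    vec5 0 0 (co x 1 * co y 1) (co x 1 * co y 2 + co x 2 * co y 1)
      (co x 2 * co y 3 + co x 3 * co y 2 + co x 1 * co y 4 + co x 4 * co y 1).
  by vec_eval; split; ring.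
by move=> x y z; rewrite !mE; apply: vecP5; rewrite !co_vec5; split; ring.
Qed.

End Main.

Theorem theorem4 (K : closedFieldType)
    (char_neq2 : 2%N \notin [pchar K]) (char_neq3 : 3%N \notin [pchar K]) :
  (forall a b : label K, listed a -> listed b -> a <> b ->
     a \simeq b -> exceptional a b \/ exceptional b a)
  /\ ((forall a1 a2 : K, J15 a1 \simeq J15 a2 <-> a1 = a2) /\
      (forall a1 a2 : K, a1 <> 1 -> a2 <> 1 ->
         (J24 a1 \simeq J24 a2 <-> a1 = a2)))
  /\ ((forall b1 b2 : K,
         J23 b1 \simeq J23 b2 <-> b1 = b2 \/ b1 = - b2) /\
      (forall b1 b2 : K,
         J26 b1 \simeq J26 b2 <-> b1 = b2 \/ b1 = - b2))
  /\ (forall a1 b1 a2 b2 : K,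
        J27 a1 b1 \simeq J27 a2 b2 <->
        (a1, b1) = (a2, b2) \/ (a1, b1) = (b2, a2))
  /\ (forall l1 l2 : K,
        J41 l1 \simeq J41 l2 <-> l1 = l2 \/ l1 = l2^-1)
  /\ (associative (table_mul (alg (J24 (1 : K)))) /\
      J24 (1 : K) \simeq eps4 K)
  /\ J29 K \simeq J24 0
  /\ J37 K \simeq J27 (- 1) (- 1)
  /\ ((forall l s : K, l <> 0 -> l <> 1 -> s ^+ 2 = l ->
         J41 l \simeq J27 (param27 s) (param27 s)^-1) /\
      J41 (1 : K) \simeq J26 0 /\
      (forall l : K,
         l <> 0 <->
         exists b : label K,
           [/\ listed b, forall m : K, b <> J41 m & J41 l \simeq b])).
Proof.
have K2 : (2%:R : K) != 0 by move: char_neq2; rewrite inE.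
have K3 : (3%:R : K) != 0 by move: char_neq3; rewrite inE.
have J41_27 (l s : K) : l <> 0 -> l <> 1 -> s ^+ 2 = l ->
    J41 l \simeq J27 (param27 s) (param27 s)^-1.
  move=> /eqP l0 /eqP l1 sl.
  apply: (same_form K2 (w := Split (param27 s)^-1 1 1 (param27 s))) => //.
  by apply: Or33; split=> //; exists s.
have J41_26 : J41 (1 : K) \simeq J26 0.
  by apply: (same_form K2 (w := Split 1 1 0 0)) => //; apply: Or32.
split; first by move=> a b _ _; apply: isomorphic_exceptional.
split.
  split=> [a1 a2|a1 a2 _ _]; split=> [|->]; try exact: isomorphic_refl.
    exact: J15_iso.
  by move/(isomorphic_forms K2 (erefl : form_of (J24 a1) (Double 0 1 a1 0 0))
    (erefl : form_of (J24 a2) (Double 0 1 a2 0 0)))/double_linear_iso.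
split.
  split=> b1 b2; split.
  - by move/(isomorphic_forms K2 (erefl : form_of (J23 b1) (Double 1 b1 0 1 0))
      (erefl : form_of (J23 b2) (Double 1 b2 0 1 0)))/double_square_iso.
  - by case=> ->; [apply: isomorphic_refl | apply: J23N].
  - by move/(isomorphic_forms K2 (erefl : form_of (J26 b1) (Split 1 1 0 b1))
      (erefl : form_of (J26 b2) (Split 1 1 0 b2)))/J26_iso.
  - by case=> ->; [apply: isomorphic_refl | apply: J26N].
split.
  move=> a1 b1 a2 b2; split.
    move/(isomorphic_forms K2 (erefl : form_of (J27 a1 b1) (Split b1 1 1 a1))
      (erefl : form_of (J27 a2 b2) (Split b2 1 1 a2)))/J27_iso.
    by case=> -[-> ->]; [left | right].
  by case=> -[-> ->]; [apply: isomorphic_refl | apply: J27C].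
split.
  move=> l1 l2; split=> [iso_l|[->|->]]; last 2 first.
  - exact: isomorphic_refl.
  - exact: J41V.
  have [l12|/eqP l12] := eqVneq l1 l2; [by left | right].
  have : J41 l1 <> J41 l2 by case.
  case/isomorphic_exceptional => // exc; inversion exc => //.
  by rewrite invrK.
split.
  split; first exact: J24_1_associative.
  exact: (same_form K2 (w := Double 0 1 1 0 0)).
split; first exact: (same_form K2 (w := Double 0 1 0 0 0)).
split; first exact: (same_form K2 (w := Split (-1) 1 1 (-1))).
split=> //; split=> // l; split=> [l0|[b [_ bJ41 iso_b]] l0].
  have [l1|/eqP l1] := eqVneq l 1; first by exists (J26 0); rewrite l1.
  have [s sl] := square_root l.
  by exists (J27 (param27 s) (param27 s)^-1); split=> //; apply: J41_27.
(* At parameter 0, only [exc41] can relate [J41 l] to another label, and its other side is again a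
   J41; the remaining constructors involving J41 have a nonzero parameter. *)
have : J41 l <> b by move=> lb; case: (bJ41 l).
case/isomorphic_exceptional => // exc; inversion exc; subst.
all: by [case: (bJ41 _ erefl) | | case: (elimN eqP (oner_neq0 K))].
Qed.
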